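(* Let $X=(X_t)_{t\ge0}$ be a Harris recurrent (irreducible, time-homogeneous) real-valued Markov chain whose kernel satisfies $P(x,A)\ge s(x)\nu(A)$ for all $x\in E$, $A\in\mathcal{E}$, where $s$ is measurable with $0\le s\le 1$, $\nu$ is a probability measure and $\int_E s\,d\nu>0$. Let $x_0\in\mathbb{R}$ and suppose there is $\delta>0$ such that $C=[x_0-\delta,x_0+\delta]$ is a small set. Let $$F_n(y)=\frac{1}{T_n(C)}\sum_{t=0}^n\mathbb{I}\{X_t\in C,\,X_t\le y\},\qquad T_n(C)=\sum_{t=0}^n\mathbb{I}\{X_t\in C\}.$$ Then there exists a stationary (invariant) $\sigma$-finite measure $\pi$ such that, with $$F(y)=\frac{\pi(C\cap(-\infty,y])}{\pi(C)},$$ one has $$\sup_{y\in\mathbb{R}}|F_n(y)-F(y)|\to0\quad\text{a.s. as }n\to\infty.$$ If, moreover, $F$ is continuous and strictly increasing on $C$ in the sense that for all $x'\in C$ and all $\epsilon>0$ there exists $\gamma>0$ such that $|F^{-1}(u)-x'|>\gamma$ for all $u$ with $|u-F(x')|\ge\epsilon$, then, for all sufficiently small $\epsilon>0$, $$\sup_{|p-F(x_0)|\le\epsilon}|F_n^{-1}(p)-F^{-1}(p)|\to0\quad\text{a.s. as }n\to\infty.$$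
   Context: $E\subseteq\mathbb{R}$ is the state space with countably generated $\sigma$-algebra $\mathcal{E}$ (Borel sets), $P(x,A)$ the transition kernel, $\psi$ the maximal irreducibility measure. Harris recurrent: for all $x\in E$ and $A\in\mathcal{E}$ with $\psi(A)>0$, $\mathbb{P}(X_n\in A\text{ infinitely often}\mid X_0=x)=1$. A measure $\pi$ is invariant if $\pi(B)=\int P(x,B)\,d\pi(x)$ for all $B\in\mathcal{E}$. A set $A\in\mathcal{E}$ with $\psi(A)>0$ is small if there are an integer $m_0\ge1$ and a nonzero positive measure $\nu'$ on $(E,\mathcal{E})$ with $P^{m_0}(x,B)\ge\mathbb{I}_A(x)\nu'(B)$ for all $x\in E$, $B\in\mathcal{E}$; a small set satisfies $0<\pi(A)<\infty$. $F_n$ is defined once $T_n(C)\ge1$, which holds for all large $n$ a.s. $F^{-1}$ is the inverse of $F$ on $C$ (defined in particular on a neighborhood of $F(x_0)$), and $u$ ranges over the values where it is defined. Let $Y_1<\dots<Y_m$ be the ordered distinct values among the $X_t$, $0\le t\le n$, lying in $C$, and $Y_0<Y_1$ an arbitrary random variable. $F_n^{-1}(a)$, for $a\le F_n(Y_m)=1$, is the smallest $y\in[Y_0,Y_m]$ with $F_n(y)\ge a$. *)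

(* Defs.v *)
From HB Require Import structures.
From mathcomp Require Import all_boot all_order all_algebra.
From mathcomp Require Import all_classical all_reals all_analysis.

Set Implicit Arguments.
Unset Strict Implicit.
Unset Printing Implicit Defensive.
Import Order.TTheory GRing.Theory Num.Theory.
Import numFieldNormedType.Exports.
Local Open Scope classical_set_scope.
Local Open Scope ring_scope.

(* A set E of reals as a measurable space, with the trace {B `&` E | B Borel}.
   Measurable types are pointed, hence the element e0, which plays no other
   role. *)
Definition pointed_set (T : choiceType) (E : set T) (e0 : E) : Type := E.

HB.instance Definition _ (T : choiceType) (E : set T) (e0 : E) :=
  Choice.copy (pointed_set e0) (set_type E).
HB.instance Definition _ (T : choiceType) (E : set T) (e0 : E) :=
  isPointed.Build (pointed_set e0) e0.

Definition to_real (R : realType) (E : set R) (e0 : E) (x : pointed_set e0) : R :=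
  set_val (x : E).
Arguments to_real {R E} e0 x.

Notation state_space e0 := (g_sigma_algebra_preimageType (to_real e0)).

Section markov.
Context (R : realType) (d : measure_display) (S : measurableType d).
Local Open Scope ereal_scope.

Fixpoint kiter (P : R.-pker S ~> S) (m : nat) (x : S) (A : set S) : \bar R :=
  if m is k.+1 then \int[P x]_y kiter P k y A else \d_x A.

Definition past (d' : measure_display) (Omega : measurableType d')
    (X : nat -> Omega -> S) (n : nat) : set_system Omega :=
  <<s \bigcup_(i in `I_n.+1) preimage_set_system setT (X i) measurable >>.

(* Pr(X_{n+1} in A | X_0, ..., X_n) = P(X_n, A) almost surely, the conditional
   probability being spelled out by its integrals over the events of the past. *)
Definition markov_chain (P : R.-pker S ~> S)
    (d' : measure_display) (Omega : measurableType d') (Pr : probability Omega R)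
    (X : nat -> {RV Pr >-> S}) : Prop :=
  forall (n : nat) (G : set Omega) (A : set S),
    past X n G -> measurable A ->
    Pr (G `&` X n.+1 @^-1` A) = \int[Pr]_(w in G) P (X n w) A.

(* Conditioning on X_0 = x means working with the chain of kernel P started
   at x.  Its law is determined by P and x, and it exists (Ionescu-Tulcea), so
   that "some chain started at x" and "every chain started at x" agree. *)
Definition harris_recurrent (P : R.-pker S ~> S) (psi : set S -> \bar R) : Prop :=
  forall (x : S) (A : set S), measurable A -> 0 < psi A ->
    exists (d' : measure_display) (Omega : measurableType d')
      (Pr_x : probability Omega R) (X : nat -> {RV Pr_x >-> S}),
      [/\ markov_chain P X,
          {ae Pr_x, forall w, X 0%N w = x} &
          Pr_x (lim_sup_set (fun n => X n @^-1` A)) = 1].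

Definition irreducibility_measure (P : R.-pker S ~> S) (phi : set S -> \bar R) :
    Prop :=
  0 < phi setT /\
  forall A : set S, measurable A -> 0 < phi A ->
    forall x : S, exists2 n : nat, (0 < n)%N & 0 < kiter P n x A.

Definition maximal_irreducibility_measure (P : R.-pker S ~> S)
    (psi : {sigma_finite_measure set S -> \bar R}) : Prop :=
  irreducibility_measure P psi /\
  forall phi : {sigma_finite_measure set S -> \bar R},
    irreducibility_measure P phi -> phi `<< psi.

Definition small_set (P : R.-pker S ~> S) (psi : set S -> \bar R) (A : set S) :
    Prop :=
  [/\ measurable A, 0 < psi A &
      exists (m0 : nat) (nu' : {measure set S -> \bar R}),
        [/\ (0 < m0)%N, 0 < nu' setT &
            forall (x : S) (B : set S), measurable B ->
              (\1_A x)%:E * nu' B <= kiter P m0 x B]].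

Definition invariant_measure (P : R.-pker S ~> S)
    (pi : {measure set S -> \bar R}) : Prop :=
  forall B : set S, measurable B -> pi B = \int[pi]_x P x B.

End markov.

Section empirical.
Context (R : realType).
Implicit Types (C : set R) (x : nat -> R) (n : nat).

Definition Tn C x n : R := \sum_(t < n.+1) \1_C (x t).

(* Equal to 0 as long as C has not been visited, by the convention 0^-1 = 0. *)
Definition Fn C x n (y : R) : R :=
  (Tn C x n)^-1 * \sum_(t < n.+1) \1_(C `&` [set z | z <= y]) (x t).

(* The sequence Y_1 < ... < Y_m. *)
Definition visited C x n : seq R :=
  sort <=%R (undup [seq x t | t <- iota 0 n.+1 & x t \in C]).

Definition Y1 C x n : R := head 0 (visited C x n).
Definition Ym C x n : R := last 0 (visited C x n).

Definition smallest (A : set R) : R := xget 0 [set y | A y /\ lbound A y].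

Definition Fn_inv C x n (Y0 a : R) : R :=
  smallest [set y | Y0 <= y <= Ym C x n /\ a <= Fn C x n y].

(* The inverse of F on C, defined on F @` C. *)
Definition F_inv C (F : R -> R) : R -> R := 'pinv_(fun=> 0) C F.

(* F_inv only makes sense for F injective on C, that is strictly increasing as F
   is monotone; u ranges over F @` C, where F_inv is defined. *)
Definition strictly_increasing_on C (F : R -> R) : Prop :=
  {in C &, {homo F : y z / y < z}} /\
  forall x' : R, C x' -> forall e : R, 0 < e ->
    exists2 g : R, 0 < g &
      forall u : R, (F @` C) u -> e <= `|u - F x'| -> g < `|F_inv C F u - x'|.

Definition stationary_cdf (E : set R) (e0 : E)
    (pi : {measure set (state_space e0) -> \bar R}) C (y : R) : R :=
  fine (pi (to_real e0 @^-1` (C `&` [set z | z <= y]))) /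
  fine (pi (to_real e0 @^-1` C)).

End empirical.

(* Main.v *)
Require Import Defs.
From HB Require Import structures.
From mathcomp Require Import all_boot all_order all_algebra.
From mathcomp Require Import all_classical all_reals all_analysis.
From mathcomp Require Import measurable_realfun.
From mathcomp Require Import ring lra.

Set Implicit Arguments.
Unset Strict Implicit.
Unset Printing Implicit Defensive.
Import Order.TTheory GRing.Theory Num.Theory.
Import numFieldNormedType.Exports.
Local Open Scope classical_set_scope.
Local Open Scope ring_scope.

(** The chain is studied through potential theory rather than through
    regeneration times and independent blocks.

    Let P^m0 >= 1_C nu' be the minorization attached to the small set C.  The
    resolvent K = sum_n 2^(-n-1) P^n then dominates 1_C lam for a positive
    multiple lam of nu', so that K = Q + 1_C lam with Q a kernel
    ([kernel_difference]): under K, the chain regenerates with law proportional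
    to lam each time it leaves C through the second term.  Put G = sum_n Q^n
    and pi = lam G.  The mass of Q is 1 - lam(S) 1_C, which makes G 1_C bounded.
    Moreover pi(C) = 1: otherwise v = K G 1_C would solve v = P v + c 1_C with
    c > 0, and iterating this bounds the expected number of visits to C, which
    is infinite for a Harris chain ([harris_visits_series]).  From
    K = Q + 1_C lam one reads off that pi K = pi, and K = (1 + K P) / 2 turns
    this into pi P = pi.  From K = (1 + P K) / 2 one gets, for each B included
    in C, a bounded solution v = K G 1_B of the Poisson equation
    1_B - pi(B) 1_C = v - P v.  All this is [regen_measureP].

    By the Poisson equation, the partial sums of 1_B(X_t) - pi(B) 1_C(X_t) form
    a martingale up to a bounded error; and they change only at visits to C.
    Stopped at the k-th visit, they have a second moment O(k)
    ([early_sum_second_moment]).  Summing over k = j^2 and using Fatou's lemma,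
    they are o(k) along squares, and hence o(k), their steps being bounded
    ([total_sum_small]).  Since the chain visits C infinitely often almost
    surely ([harris_visits_io]), the proportion of the visits to C that fall in
    B tends to pi(B) almost surely, for each fixed B ([small_set_ergodic]).

    Uniformity in y is the Glivenko-Cantelli argument on a countable grid of
    quantiles of F ([grid_uniform_cvg]).  Convergence of the quantiles follows,
    as F increases by a definite amount over every interval of given length
    that starts in the middle part of C ([quantile_cvg]). *)

(** * Kernels acting on measures and functions *)

Section mixture.
Context (R : realType) d1 d2 (T : measurableType d1) (S : measurableType d2).
Local Open Scope ereal_scope.
Variables (mu : {measure set T -> \bar R}) (k : R.-ker T ~> S).

Definition mixture (A : set S) : \bar R := \int[mu]_x k x A.

Let mixture0 : mixture set0 = 0.
Proof. by rewrite /mixture integral0_eq// => x _; rewrite measure0. Qed.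

Let mixture_ge0 A : 0 <= mixture A.
Proof. exact: integral_ge0. Qed.

Let mixture_sigma_additive : semi_sigma_additive mixture.
Proof.
move=> U mU tU mUU; rewrite [X in _ --> X](_ : _ =
  \int[mu]_x (\sum_(n <oo) k x (U n))); last first.
  by apply: eq_integral => V _; exact/esym/cvg_lim/measure_semi_sigma_additive.
apply/cvg_closeP; split.
  by apply: is_cvg_nneseries => n _ _; exact: integral_ge0.
by rewrite closeE// integral_nneseries// => n; exact: measurable_kernel.
Qed.

HB.instance Definition _ := isMeasure.Build _ _ R
  mixture mixture0 mixture_ge0 mixture_sigma_additive.

Definition mmixture : {measure set S -> \bar R} := mixture.

Import HBNNSimple.

(** By linearity the identity extends from sets to simple functions, and by
    monotone convergence to nonnegative functions. *)
Lemma integral_mixture (f : S -> \bar R) :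
  (forall y, 0 <= f y) -> measurable_fun [set: S] f ->
  \int[mmixture]_y f y = \int[mu]_x \int[k x]_y f y.
Proof.
move=> f0 mf.
pose f_ := nnsfun_approx measurableT mf.
have f_0 n y : 0 <= (f_ n y)%:E by rewrite lee_fin.
have mf_ n : measurable_fun [set: S] (EFin \o f_ n) by exact/measurable_EFinP.
have ndf y : {homo (fun n => (f_ n y)%:E) : m n / (m <= n)%N >-> m <= n}.
  by move=> a b ab; rewrite lee_fin; exact/lefP/nd_nnsfun_approx.
have f_f y : limn (fun n => (f_ n y)%:E) = f y.
  by apply/cvg_lim => //; exact: cvg_nnsfun_approx.
have simple n :
    \int[mmixture]_y (f_ n y)%:E = \int[mu]_x \int[k x]_y (f_ n y)%:E.
  rewrite integralT_nnsfun sintegralE.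
  transitivity (\int[mu]_x \sum_(r \in range (f_ n))
      (r%:E * k x (f_ n @^-1` [set r]))); last first.
    by apply: eq_integral => x _; rewrite integralT_nnsfun sintegralE.
  rewrite ge0_integral_fsum//.
  - apply: eq_fsbigr => r; rewrite inE => -[z _ /= <-].
    rewrite ge0_integralZl//; try by rewrite ?lee_fin; exact: fun_ge0.
    exact: measurable_kernel.
  - by move=> r; apply: measurable_funeM; exact: measurable_kernel.
  - move=> r x _; have := mulemu_ge0 (fun r => f_ n @^-1` [set r]).
    by apply; exact: preimage_nnfun0.
transitivity (\int[mmixture]_y limn (fun n => (f_ n y)%:E)).
  by apply: eq_integral => y _; rewrite f_f.
rewrite monotone_convergence//.
transitivity (\int[mu]_x limn (fun n => \int[k x]_y (f_ n y)%:E)).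
  rewrite monotone_convergence//.
  - by congr (limn _); apply/funext => n; exact: simple.
  - move=> n; apply: measurable_fun_integral_kernel => //.
      exact: measurable_kernel.
    exact: mf_.
  - by move=> n x _; exact: integral_ge0.
  - by move=> x _ a b ab; apply: ge0_le_integral => //;
      [exact: mf_|exact: mf_|move=> y _; exact: ndf].
apply: eq_integral => x _; rewrite -monotone_convergence//.
by apply: eq_integral => y _; rewrite f_f.
Qed.

End mixture.

Section kernel_operators.
Context (R : realType) d1 d2 (T : measurableType d1) (S : measurableType d2).
Local Open Scope ereal_scope.

Definition kint (k : R.-ker T ~> S) (f : S -> \bar R) (x : T) : \bar R :=
  \int[k x]_y f y.

Lemma kint_ge0 k f x : (forall y, 0 <= f y) -> 0 <= kint k f x.
Proof. by move=> f0; exact: integral_ge0. Qed.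

Lemma measurable_kint k f : (forall y, 0 <= f y) ->
  measurable_fun [set: S] f -> measurable_fun [set: T] (kint k f).
Proof.
move=> f0 mf; apply: measurable_fun_integral_kernel => //.
exact: measurable_kernel.
Qed.

Lemma kint_indic (k : R.-ker T ~> S) A x : measurable A ->
  kint k (fun y => (\1_A y)%:E) x = k x A.
Proof. by move=> mA; rewrite /kint integral_indic// setIT. Qed.

Lemma kint_cst (k : R.-ker T ~> S) r x : kint k (cst r) x = r * k x setT.
Proof. by rewrite /kint integral_cst. Qed.

Lemma kintD k f g x : (forall y, 0 <= f y) -> measurable_fun [set: S] f ->
  (forall y, 0 <= g y) -> measurable_fun [set: S] g ->
  kint k (f \+ g) x = kint k f x + kint k g x.
Proof. by move=> *; rewrite /kint ge0_integralD. Qed.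

Lemma kintZ k (r : R) f x : (0 <= r)%R -> (forall y, 0 <= f y) ->
  measurable_fun [set: S] f ->
  kint k (fun y => r%:E * f y) x = r%:E * kint k f x.
Proof. by move=> *; rewrite /kint ge0_integralZl. Qed.

Lemma le_kint k f g x : (forall y, 0 <= f y) -> measurable_fun [set: S] f ->
  measurable_fun [set: S] g -> (forall y, f y <= g y) ->
  kint k f x <= kint k g x.
Proof. by move=> f0 mf mg fg; apply: ge0_le_integral => // y _; exact: fg. Qed.

Lemma kint_nneseries k (f : nat -> S -> \bar R) x : (forall n y, 0 <= f n y) ->
  (forall n, measurable_fun [set: S] (f n)) ->
  kint k (fun y => \sum_(n <oo) f n y) x = \sum_(n <oo) kint k (f n) x.
Proof. by move=> f0 mf; rewrite /kint integral_nneseries. Qed.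

Definition kscale (c : {nonneg R}) (k : R.-ker T ~> S) (x : T) :
  {measure set S -> \bar R} := mscale c (k x).

Let measurable_kscale c k U : measurable U ->
  measurable_fun [set: T] (kscale c k ^~ U).
Proof. by move=> mU; apply: measurable_funeM; exact: measurable_kernel. Qed.

HB.instance Definition _ c k := isKernel.Build _ _ _ _ _ (kscale c k)
  (@measurable_kscale c k).

Lemma kint_kscale c (k : R.-ker T ~> S) f x : (forall y, 0 <= f y) ->
  measurable_fun [set: S] f -> kint (kscale c k) f x = c%:num%:E * kint k f x.
Proof. by move=> f0 mf; rewrite /kint ge0_integral_mscale. Qed.

Lemma kint_kseries (k : nat -> R.-ker T ~> S) f x : (forall y, 0 <= f y) ->
  measurable_fun [set: S] f ->
  kint (kseries k) f x = \sum_(n <oo) kint (k n) f x.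
Proof. by move=> f0 mf; exact: integral_kseries. Qed.

End kernel_operators.

Section kernel_power.
Context (R : realType) d (S : measurableType d).
Local Open Scope ereal_scope.
Implicit Types k l : R.-ker S ~> S.

Definition kcat l k (x : S) : {measure set S -> \bar R} := mmixture (l x) k.

Let measurable_kcat l k U : measurable U ->
  measurable_fun [set: S] (kcat l k ^~ U).
Proof.
move=> mU; apply: (@measurable_kint _ _ _ _ _ l (k ^~ U)) => //.
exact: measurable_kernel.
Qed.

HB.instance Definition _ l k :=
  isKernel.Build _ _ _ _ _ (kcat l k) (@measurable_kcat l k).

Fixpoint kpow k n : R.-ker S ~> S :=
  if n is m.+1 then kcat k (kpow k m) else kdirac (@measurable_id _ S setT).

Lemma kint_pow0 k f x : measurable_fun [set: S] f -> kint (kpow k 0) f x = f x.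
Proof. by move=> mf; rewrite /kint/= integral_dirac// diracT mul1e. Qed.

Lemma kint_powS k n f x : (forall y, 0 <= f y) -> measurable_fun [set: S] f ->
  kint (kpow k n.+1) f x = kint k (kint (kpow k n) f) x.
Proof. by move=> f0 mf; exact: integral_mixture. Qed.

Lemma kint_powSr k n f x : (forall y, 0 <= f y) -> measurable_fun [set: S] f ->
  kint (kpow k n.+1) f x = kint (kpow k n) (kint k f) x.
Proof.
move=> f0 mf; have mkf := measurable_kint k f0 mf.
have kf0 y : 0 <= kint k f y by exact: kint_ge0.
elim: n x => [x|n IH x].
  rewrite kint_powS// kint_pow0//.
  by apply: eq_integral => y _; rewrite kint_pow0.
rewrite kint_powS// [RHS]kint_powS//.
by apply: eq_integral => y _; rewrite IH.
Qed.

Lemma kiter_kpow (P : R.-pker S ~> S) n x A : kiter P n x A = kpow P n x A.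
Proof. by elim: n x => [//|n IH x] /=; apply: eq_integral => y _; rewrite IH. Qed.

Lemma kpowT (P : R.-pker S ~> S) n x : kpow P n x setT = 1.
Proof.
elim: n x => [x|n IH x]; first by rewrite /= diracT.
rewrite /=/mixture; under eq_integral do rewrite IH.
by rewrite integral_cst// mul1e prob_kernel.
Qed.

End kernel_power.

(** * The resolvent and its splitting *)

Section resolvent.
Context (R : realType) d (S : measurableType d) (P : R.-pker S ~> S).
Local Open Scope ereal_scope.

Lemma half_pow_ge0 n : (0 <= 2^-1 ^+ n.+1 :> R)%R.
Proof. by rewrite exprn_ge0// invr_ge0. Qed.

Definition half_pow n : {nonneg R} := NngNum (half_pow_ge0 n).

Definition resolvent : S -> {measure set S -> \bar R} :=
  kseries (fun n => kscale (half_pow n) (kpow P n)).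

HB.instance Definition _ := Kernel.on resolvent.

Lemma kint_resolvent f x : (forall y, 0 <= f y) -> measurable_fun [set: S] f ->
  kint resolvent f x = \sum_(n <oo) (2^-1 ^+ n.+1)%:E * kint (kpow P n) f x.
Proof.
move=> f0 mf; rewrite kint_kseries//.
by apply: eq_eseriesr => n _; rewrite kint_kscale.
Qed.

Let summand_ge0 f x n : (forall y, 0 <= f y) ->
  0 <= (2^-1 ^+ n.+1 : R)%:E * kint (kpow P n) f x.
Proof. by move=> f0; rewrite mule_ge0 ?lee_fin ?half_pow_ge0 ?kint_ge0. Qed.

(** Peeling off the first term of the series leaves half of a series of the same
    form.  Writing P^(n+1) as P P^n or as P^n P yields the next two lemmas. *)
Let resolvent_shift f g x : (forall y, 0 <= f y) -> measurable_fun [set: S] f ->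
  (forall n, kint (kpow P n.+1) f x = g n) -> (forall n, 0 <= g n) ->
  kint resolvent f x =
  2^-1%:E * f x + 2^-1%:E * \sum_(n <oo) (2^-1 ^+ n.+1)%:E * g n.
Proof.
move=> f0 mf fg g0; rewrite kint_resolvent// nneseries_recl//; last first.
  by move=> n _; exact: summand_ge0.
rewrite expr1 kint_pow0//; congr (_ + _).
rewrite -nneseriesZl; last first.
  by move=> i _; rewrite mule_ge0 ?lee_fin ?half_pow_ge0.
rewrite -nneseries_addn; last by move=> n; exact: summand_ge0.
by apply: eq_eseriesr => n _; rewrite addn1 fg exprS EFinM muleA.
Qed.

Lemma resolventEl f x : (forall y, 0 <= f y) -> measurable_fun [set: S] f ->
  kint resolvent f x =
  2^-1%:E * f x + 2^-1%:E * kint P (kint resolvent f) x.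
Proof.
move=> f0 mf.
rewrite (@resolvent_shift f (fun n => kint P (kint (kpow P n) f) x))//.
- congr (_ + _ * _).
  transitivity (\sum_(n <oo)
      kint P (fun y => (2^-1 ^+ n.+1)%:E * kint (kpow P n) f y) x).
    apply: eq_eseriesr => n _; rewrite kintZ ?half_pow_ge0//.
      by move=> y; exact: kint_ge0.
    exact: measurable_kint.
  rewrite -kint_nneseries.
  + by apply: eq_integral => y _; rewrite kint_resolvent.
  + by move=> n y; exact: summand_ge0.
  + by move=> n; apply: measurable_funeM; exact: measurable_kint.
- by move=> n; rewrite kint_powS.
- by move=> n; apply: kint_ge0 => y; exact: kint_ge0.
Qed.

Lemma resolventEr f x : (forall y, 0 <= f y) -> measurable_fun [set: S] f ->
  kint resolvent f x =
  2^-1%:E * f x + 2^-1%:E * kint resolvent (kint P f) x.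
Proof.
move=> f0 mf; have Pf0 y : 0 <= kint P f y by exact: kint_ge0.
rewrite (@resolvent_shift f (fun n => kint (kpow P n) (kint P f) x))//.
- by rewrite [in RHS]kint_resolvent//; exact: measurable_kint.
- by move=> n; rewrite kint_powSr.
- by move=> n; apply: kint_ge0.
Qed.

Lemma resolventT x : resolvent x setT = 1.
Proof.
rewrite -[LHS]mul1e -(kint_cst resolvent) kint_resolvent//.
have := @cvg_geometric_eseries_half R 1 0.
rewrite expr0 divr1 => /cvg_lim lim1; rewrite -[RHS]lim1//.
apply/congr_lim/funext => n; apply: eq_bigr => i _.
by rewrite kint_cst kpowT !mule1 addn1 div1r natrX exprVn.
Qed.

Lemma kpow_le_resolvent n x A : measurable A ->
  (2^-1 ^+ n.+1)%:E * kpow P n x A <= resolvent x A.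
Proof.
move=> mA; rewrite -(kint_indic resolvent)// -(kint_indic (kpow P n))//.
have i0 y : 0 <= (\1_A y : R)%:E by rewrite lee_fin.
have mi : measurable_fun [set: S] (fun y => (\1_A y : R)%:E).
  by apply/measurable_EFinP; exact: measurable_indic.
rewrite kint_resolvent// (nneseriesD1 (n := n))//.
  by rewrite leeDl// nneseries_ge0// => k _ _; exact: summand_ge0.
by move=> k _; exact: summand_ge0.
Qed.

End resolvent.

Section kernel_difference.
Context (R : realType) d (S : measurableType d).
Local Open Scope ereal_scope.
Variables (K : R.-ker S ~> S) (C : set S) (lam : {measure set S -> \bar R}).
Hypothesis mC : measurable C.
Hypothesis KT : forall x, K x setT < +oo.
Hypothesis lamT : lam setT < +oo.
Hypothesis lamK : forall x A, measurable A -> (\1_C x)%:E * lam A <= K x A.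

(** The maximum with 0 ensures nonnegativity on all sets; on measurable sets the
    difference is already nonnegative. *)
Definition kdiff_fun (x : S) (A : set S) : \bar R :=
  maxe 0 (K x A - (\1_C x)%:E * lam A).

Let lam_fin A : measurable A -> lam A \is a fin_num.
Proof.
move=> mA; rewrite ge0_fin_numE//; apply: le_lt_trans lamT.
by apply: le_measure; rewrite ?inE.
Qed.

Let K_fin x A : measurable A -> K x A \is a fin_num.
Proof.
move=> mA; rewrite ge0_fin_numE//; apply: le_lt_trans (KT x).
by apply: le_measure; rewrite ?inE.
Qed.

Let kdiff_funE x A : measurable A ->
  kdiff_fun x A = K x A - (\1_C x)%:E * lam A.
Proof.
by move=> mA; rewrite /kdiff_fun max_r// sube_ge0 ?lamK// fin_numM// lam_fin.
Qed.

Let kdiff0 x : kdiff_fun x set0 = 0.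
Proof. by rewrite kdiff_funE// !measure0 mule0 sube0. Qed.

Let kdiff_ge0 x A : 0 <= kdiff_fun x A.
Proof. by rewrite /kdiff_fun le_max lexx. Qed.

Let kdiff_sigma_additive x : semi_sigma_additive (kdiff_fun x).
Proof.
move=> U mU tU mUU; rewrite kdiff_funE//.
rewrite (_ : (fun n => _) = (fun n => (\sum_(0 <= i < n) K x (U i)) -
   (\1_C x)%:E * (\sum_(0 <= i < n) lam (U i)))); last first.
  apply/funext => n; rewrite ge0_sume_distrr//.
  rewrite -sumeN; last first.
    move=> i j _ _; rewrite fin_num_adde_defl// fin_numM// lam_fin//.
  by rewrite -big_split/=; apply: eq_bigr => i _; rewrite kdiff_funE.
apply: cvgeB.
- by rewrite fin_num_adde_defr// K_fin.
- exact: measure_semi_sigma_additive.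
- apply: cvgeZl => //; exact: measure_semi_sigma_additive.
Qed.

HB.instance Definition _ x := isMeasure.Build _ _ R
  (kdiff_fun x) (kdiff0 x) (kdiff_ge0 x) (@kdiff_sigma_additive x).

Definition kdiff_measure (x : S) : {measure set S -> \bar R} := kdiff_fun x.

Let measurable_kdiff A : measurable A ->
  measurable_fun [set: S] (kdiff_measure ^~ A).
Proof.
move=> mA; rewrite /kdiff_measure/= /kdiff_fun; apply: measurable_maxe => //.
apply: emeasurable_funB; first exact: measurable_kernel.
apply: emeasurable_funM => //; apply/measurable_EFinP.
exact: measurable_indic.
Qed.

HB.instance Definition _ :=
  isKernel.Build _ _ _ _ _ kdiff_measure measurable_kdiff.

Lemma kernel_difference : exists Q : R.-ker S ~> S,
  forall x A, measurable A -> K x A = Q x A + (\1_C x)%:E * lam A.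
Proof.
exists kdiff_measure => x A mA.
by rewrite /kdiff_measure/= kdiff_funE// subeK// fin_numM// lam_fin.
Qed.

End kernel_difference.

(** * Potential of the killed kernel: invariance and Poisson equation *)

Section regeneration.
Context (R : realType) d (S : measurableType d) (P : R.-pker S ~> S).
Local Open Scope ereal_scope.
Variables (C : set S) (lam : {measure set S -> \bar R}).
Hypothesis mC : measurable C.
Hypothesis lam_gt0 : 0 < lam setT.
Hypothesis lam_ltoo : lam setT < +oo.
Hypothesis recurrent : forall x, \sum_(n <oo) kpow P n x C = +oo.

Let K : R.-ker S ~> S := resolvent P.
Let c1 (y : S) : \bar R := (\1_C y)%:E.

Let c1_ge0 y : 0 <= c1 y. Proof. by rewrite lee_fin. Qed.
Let mc1 : measurable_fun [set: S] c1.
Proof. by apply/measurable_EFinP; exact: measurable_indic. Qed.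

Variable Q : R.-ker S ~> S.
Hypothesis KQ :
  forall x A, measurable A -> K x A = Q x A + (\1_C x)%:E * lam A.

Let kintKQ f x : (forall y, 0 <= f y) -> measurable_fun [set: S] f ->
  kint K f x = kint Q f x + c1 x * \int[lam]_y f y.
Proof.
move=> f0 mf.
have i0 : (0 <= \1_C x :> R)%R by [].
rewrite /kint (@eq_measure_integral _ _ _ _
   (measure_add (Q x) (mscale (NngNum i0) lam))); last first.
  by move=> A mA _; rewrite KQ//; exact/esym/measure_addE.
by rewrite ge0_integral_measure_add// ge0_integral_mscale.
Qed.

Let G : R.-ker S ~> S := kseries (kpow Q).

Let GEl f x : (forall y, 0 <= f y) -> measurable_fun [set: S] f ->
  kint G f x = f x + kint Q (kint G f) x.
Proof.
move=> f0 mf; rewrite kint_kseries// nneseries_recl//; last first.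
  by move=> n _; exact: kint_ge0.
rewrite kint_pow0// -nneseries_addn; last by move=> n; exact: kint_ge0.
congr (_ + _); transitivity (\sum_(n <oo) kint Q (kint (kpow Q n) f) x).
  by apply: eq_eseriesr => n _; rewrite addn1 kint_powS.
rewrite -kint_nneseries.
- by apply: eq_integral => y _; rewrite kint_kseries.
- by move=> n y; exact: kint_ge0.
- by move=> n; exact: measurable_kint.
Qed.

Let GEr f x : (forall y, 0 <= f y) -> measurable_fun [set: S] f ->
  kint G f x = f x + kint G (kint Q f) x.
Proof.
move=> f0 mf; rewrite kint_kseries// nneseries_recl//; last first.
  by move=> n _; exact: kint_ge0.
rewrite kint_pow0// -nneseries_addn; last by move=> n; exact: kint_ge0.
congr (_ + _); rewrite kint_kseries;
  [|by move=> y; exact: kint_ge0|exact: measurable_kint].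
by apply: eq_eseriesr => n _; rewrite addn1 kint_powSr.
Qed.

Definition regen_measure : {measure set S -> \bar R} :=
  mmixture lam (kseries (kpow Q)).
Let pi := regen_measure.

Let piE f : (forall y, 0 <= f y) -> measurable_fun [set: S] f ->
  \int[pi]_y f y = \int[lam]_x kint G f x.
Proof. by move=> f0 mf; exact: integral_mixture. Qed.

(** The Poisson equation of K: add 1_C lam to the identity G = 1 + Q G. *)
Let KGE f x : (forall y, 0 <= f y) -> measurable_fun [set: S] f ->
  kint K (kint G f) x + f x = kint G f x + c1 x * \int[pi]_y f y.
Proof.
move=> f0 mf; rewrite kintKQ; last 2 first.
- by move=> y; exact: kint_ge0.
- exact: measurable_kint f0 mf.
by rewrite piE// [in RHS]GEl// addeAC; congr (_ + _); rewrite addeC.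
Qed.

Let beta := lam setT.
Let beta_fin : beta \is a fin_num.
Proof. by rewrite /beta ge0_fin_numE. Qed.
Let b : R := fine beta.
Let b_gt0 : (0 < b)%R. Proof. by rewrite fine_gt0// /beta lam_gt0. Qed.
Let bE : beta = b%:E. Proof. by rewrite fineK. Qed.
Let M : R := (b^-1)%R.

(** A telescoping sum, since the mass missing from Q is lam(S) 1_C. *)
Let potential_partial n x :
  \sum_(k < n) b%:E * kint (kpow Q k) c1 x + kint (kpow Q n) (cst 1) x = 1.
Proof.
elim: n => [|n IH]; first by rewrite big_ord0 add0e kint_pow0.
rewrite big_ord_recr/= -addeA -[RHS]IH; congr (_ + _).
have -> : kint (kpow Q n) (cst 1) x =
    kint (kpow Q n) (kint Q (cst 1) \+ (fun y => b%:E * c1 y)) x.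
  apply: eq_integral => y _ /=.
  rewrite -[LHS](resolventT P y) -[LHS]mul1e -(kint_cst (resolvent P)) kintKQ//.
  by rewrite integral_cst// mul1e -/beta bE muleC.
rewrite kintD.
- by rewrite -kint_powSr// kintZ ?(ltW b_gt0)// addeC.
- by move=> y; exact: kint_ge0.
- exact: measurable_kint.
- by move=> y; rewrite mule_ge0// lee_fin ltW.
- exact: measurable_funeM.
Qed.

Let u_le x : kint G c1 x <= M%:E.
Proof.
rewrite kint_kseries//.
apply: lime_le; first by apply: is_cvg_nneseries => n _ _; exact: kint_ge0.
apply: nearW => n.
rewrite -(@lee_pmul2l _ b%:E)// -EFinM divff ?gt_eqF//.
rewrite -(potential_partial n x) big_mkord.
rewrite ge0_sume_distrr; last by move=> i _; exact: kint_ge0.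
by rewrite leeDl// kint_ge0.
Qed.

Let g_le f x : (forall y, 0 <= f y) -> measurable_fun [set: S] f ->
  (forall y, f y <= c1 y) -> kint G f x <= M%:E.
Proof. by move=> f0 mf fc; apply: le_trans (u_le x); exact: le_kint. Qed.

Let w_le f x : (forall y, 0 <= f y) -> measurable_fun [set: S] f ->
  (forall y, f y <= c1 y) -> kint K (kint G f) x <= M%:E.
Proof.
move=> f0 mf fc.
rewrite -[leRHS]mule1 -(resolventT P x) -(kint_cst (resolvent P)).
apply: le_kint => //.
- by move=> y; exact: kint_ge0.
- exact: measurable_kint.
- by move=> y; exact: g_le.
Qed.

Let Pw_le f x : (forall y, 0 <= f y) -> measurable_fun [set: S] f ->
  (forall y, f y <= c1 y) -> kint P (kint K (kint G f)) x <= M%:E.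
Proof.
move=> f0 mf fc.
have g0 y : 0 <= kint G f y by exact: kint_ge0.
have mg := measurable_kint G f0 mf.
rewrite -[leRHS]mule1 -(@prob_kernel _ _ _ _ _ P x) -(kint_cst P).
apply: le_kint => //.
- by move=> y; exact: kint_ge0.
- exact: measurable_kint.
- by move=> y; exact: w_le.
Qed.

Let piC_le1 : pi C <= 1.
Proof.
rewrite -(setIT C) -integral_indic// piE//.
rewrite [leRHS](_ : _ = \int[lam]_x (M%:E)); last first.
  by rewrite integral_cst// -/beta bE -EFinM /M mulVf ?gt_eqF.
apply: ge0_le_integral => //.
- by move=> y _; exact: kint_ge0.
- exact: measurable_kint.
Qed.

Let pi_le f : (forall y, 0 <= f y) -> measurable_fun [set: S] f ->
  (forall y, f y <= c1 y) -> \int[pi]_y f y <= 1.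
Proof.
move=> f0 mf fc; apply: le_trans piC_le1.
rewrite -[in leRHS](setIT C) -integral_indic//.
by apply: ge0_le_integral => // y _; exact: fc.
Qed.

Let fin_le (a : \bar R) (r : R) : 0 <= a -> a <= r%:E -> a = (fine a)%:E.
Proof.
by move=> a0 ar; rewrite fineK// ge0_fin_numE// (le_lt_trans ar)// ltry.
Qed.

(** The equation for K becomes one for P because 2 K = 1 + P K. *)
Let poisson f x : (forall y, 0 <= f y) -> measurable_fun [set: S] f ->
  (forall y, f y <= c1 y) ->
  f x + kint P (kint K (kint G f)) x =
  kint K (kint G f) x + c1 x * \int[pi]_y f y.
Proof.
move=> f0 mf fc.
have g0 y : 0 <= kint G f y by exact: kint_ge0.
have mg := measurable_kint G f0 mf.
have w0 y : 0 <= kint K (kint G f) y by exact: kint_ge0.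
have := KGE x f0 mf; have := resolventEl P x g0 mg; rewrite -/K.
rewrite (fin_le (kint_ge0 _ _ w0) (Pw_le x f0 mf fc)).
rewrite (fin_le (w0 x) (w_le x f0 mf fc)).
rewrite (fin_le (g0 x) (g_le x f0 mf fc)) (@fin_le (f x) 1)//; last first.
  by rewrite (le_trans (fc x))// lee_fin indicE; case: (_ \in _).
rewrite (fin_le (integral_ge0 _ _) (pi_le f0 mf fc))//.
rewrite /c1 -!EFinM -!EFinD => -[e1] [e2]; congr (_%:E).
by move: e1 e2; set a := fine _; lra.
Qed.

(** A deficit 1 - pi(C) > 0 would act as a positive source on C for the bounded
    function w, and would be collected at every visit to C. *)
Let piC : pi C = 1.
Proof.
apply/eqP; rewrite eq_le piC_le1/= leNgt; apply/negP => piC_lt1.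
have piCE : pi C = (fine (pi C))%:E by exact: fin_le piC_le1.
set p := fine (pi C) in piCE.
have p_lt1 : (p < 1)%R by rewrite piCE in piC_lt1.
pose w := kint K (kint G c1).
have g0 y : 0 <= kint G c1 y by exact: kint_ge0.
have mg := measurable_kint G c1_ge0 mc1.
have w0 y : 0 <= w y by exact: kint_ge0.
have mw : measurable_fun [set: S] w by exact: measurable_kint.
have wE x : w x = kint P w x + (1 - p)%:E * c1 x.
  have := @poisson c1 x c1_ge0 mc1 (fun=> lexx _).
  rewrite integral_indic// setIT piCE -/w.
  rewrite (fin_le (kint_ge0 P x w0) (Pw_le x c1_ge0 mc1 (fun=> lexx _))).
  rewrite (fin_le (w0 x) (w_le x c1_ge0 mc1 (fun=> lexx _))).
  rewrite /c1 -!EFinM -!EFinD => -[e]; congr (_%:E).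
  by move: e; lra.
have wnE n x :
    w x = kint (kpow P n) w x + (1 - p)%:E * \sum_(k < n) kpow P k x C.
  elim: n => [|n ->]; first by rewrite big_ord0 mule0 adde0 kint_pow0.
  have -> : kint (kpow P n) w x =
      kint (kpow P n.+1) w x + (1 - p)%:E * kpow P n x C.
    rewrite kint_powSr// -(kint_indic (kpow P n))//.
    rewrite -kintZ ?subr_ge0 ?(ltW p_lt1)//.
    rewrite -kintD//.
    - by apply: eq_integral => y _; rewrite /= -wE.
    - by move=> y; exact: kint_ge0.
    - exact: measurable_kint.
    - by move=> y; rewrite mule_ge0// lee_fin subr_ge0 ltW.
    - exact: measurable_funeM.
  by rewrite big_ord_recr/= ge0_muleDr ?sume_ge0// -addeA [X in _ + X]addeC.
have x : S := point.
have : \sum_(n <oo) kpow P n x C <= (M / (1 - p))%:E.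
  apply: lime_le; first by apply: is_cvg_nneseries.
  apply: nearW => n; rewrite big_mkord.
  rewrite -(@lee_pmul2l _ (1 - p)%:E)// ?lte_fin ?subr_gt0//.
  rewrite -EFinM mulrCA divff ?subr_eq0 ?gt_eqF// mulr1.
  apply: le_trans (w_le x c1_ge0 mc1 (fun=> lexx _)); rewrite -/w (wnE n x).
  by rewrite leeDr// kint_ge0.
by rewrite recurrent.
Qed.

(** Since pi(C) = 1, pi K = pi Q + lam, which is pi because G = 1 + G Q. *)
Let pi_K f : (forall y, 0 <= f y) -> measurable_fun [set: S] f ->
  \int[pi]_y kint K f y = \int[pi]_y f y.
Proof.
move=> f0 mf.
have Kf0 y : 0 <= kint K f y by exact: kint_ge0.
have mKf := measurable_kint K f0 mf.
have Qf0 y : 0 <= kint Q f y by exact: kint_ge0.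
have mQf := measurable_kint Q f0 mf.
have I0 : 0 <= \int[lam]_y f y by exact: integral_ge0.
have GQf0 y : 0 <= kint G (kint Q f) y by exact: kint_ge0.
have mGQf := measurable_kint G Qf0 mQf.
have Gc0 y : 0 <= kint G c1 y by exact: kint_ge0.
have mGc := measurable_kint G c1_ge0 mc1.
have -> : \int[pi]_y kint K f y =
    \int[pi]_y kint Q f y + pi C * \int[lam]_y f y.
  under eq_integral do rewrite kintKQ//.
  rewrite ge0_integralD//; last 2 first.
  - by move=> y _; rewrite mule_ge0.
  - exact: emeasurable_funM.
  by rewrite ge0_integralZr// integral_indic// setIT.
rewrite piC mul1e !piE//.
rewrite addeC -ge0_integralD//.
by apply: eq_integral => y _; rewrite [RHS]GEr.
Qed.

(** Finiteness of pi(A) is what allows pi(A) / 2 to be cancelled in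
    pi(A) = pi(A) / 2 + (pi P)(A) / 2. *)
Let pi_P_fin A : measurable A -> pi A < +oo -> pi A = \int[pi]_x P x A.
Proof.
move=> mA piA.
pose f y : \bar R := (\1_A y)%:E.
have f0 y : 0 <= f y by rewrite lee_fin.
have mf : measurable_fun [set: S] f.
  by apply/measurable_EFinP; exact: measurable_indic.
have Pf0 y : 0 <= kint P f y by exact: kint_ge0.
have mPf := measurable_kint P f0 mf.
have KPf0 y : 0 <= kint K (kint P f) y by exact: kint_ge0.
have mKPf := measurable_kint K Pf0 mPf.
have hE : \int[pi]_y f y = pi A by rewrite integral_indic// setIT.
have PE : \int[pi]_y kint P f y = \int[pi]_x P x A.
  by apply: eq_integral => x _; rewrite kint_indic.
have := pi_K f0 mf.
under eq_integral do rewrite resolventEr//.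
have half0 : 0 <= (2^-1 : R)%:E by rewrite lee_fin invr_ge0.
clearbody f.
rewrite ge0_integralD//; last 4 first.
- by move=> y _; apply: mule_ge0; [exact: half0|exact: f0].
- exact: measurable_funeM.
- by move=> y _; apply: mule_ge0; [exact: half0|exact: KPf0].
- exact: measurable_funeM.
rewrite -/K (ge0_integralZl _ _ mf)// (ge0_integralZl _ _ mKPf)// pi_K// PE hE.
have /fineK <- : pi A \is a fin_num by rewrite ge0_fin_numE.
case: (\int[pi]_x P x A) => [r||].
- by rewrite -!EFinM -EFinD => -[e]; congr (_%:E); move: e; lra.
- by rewrite mulry gtr0_sg ?mul1e.
- by rewrite mulrNy gtr0_sg ?mul1e.
Qed.

(** These sets exhaust the space, as C is reached from every point, and
    pi K = pi together with pi(C) = 1 bounds their measure. *)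
Let level j : set S := [set x | (j.+1%:R^-1)%:E <= K x C].

Let mlevel j : measurable (level j).
Proof.
rewrite -[level j]setTI.
by apply: emeasurable_fun_c_infty => //; exact: measurable_kernel.
Qed.

Let level_nd : {homo level : m n / (m <= n)%N >-> (m <= n)%O}.
Proof.
move=> m n mn; apply/subsetPset => x; rewrite /level/=; apply: le_trans.
by rewrite lee_fin lef_pV2 ?posrE// ler_nat.
Qed.

Let level_cover : \bigcup_j level j = setT.
Proof.
apply/seteqP; split => // x _.
have [n Pn] : exists n, 0 < kpow P n x C.
  apply: contrapT => /forallNP P0; have := recurrent x.
  rewrite eseries0// => n _ _; apply/eqP; rewrite eq_le measure_ge0 andbT.
  by rewrite leNgt; apply/negP.
have : 0 < K x C.
  apply: lt_le_trans (kpow_le_resolvent P n x mC).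
  by rewrite mule_gt0// lte_fin exprn_gt0.
have /fineK <- : K x C \is a fin_num.
  rewrite ge0_fin_numE// (@le_lt_trans _ _ 1) ?ltry//.
  by rewrite -(resolventT P x) le_measure ?inE.
rewrite lte_fin => Kx.
exists (Num.truncn (fine (K x C))^-1) => //=; rewrite /level/=.
have /fineK <- : K x C \is a fin_num.
  rewrite ge0_fin_numE// (@le_lt_trans _ _ 1) ?ltry//.
  by rewrite -(resolventT P x) le_measure ?inE.
rewrite lee_fin -[leRHS]invrK lef_pV2 ?posrE ?invr_gt0//.
exact/ltW/truncnS_gt.
Qed.

Let pi_level j : pi (level j) < +oo.
Proof.
have : \int[pi]_x ((\1_(level j) x)%:E) <=
    \int[pi]_x (j.+1%:R%:E * kint K c1 x).
  apply: ge0_le_integral => //.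
  - by apply/measurable_EFinP; exact: measurable_indic.
  - by apply: measurable_funeM; exact: measurable_kint.
  - move=> x _; rewrite indicE.
    case: (boolP (x \in level j)) => [|_]/=; last first.
      by apply: mule_ge0; [rewrite lee_fin|exact: kint_ge0].
    rewrite inE /level/= kint_indic// => h.
    have -> : 1%:E = j.+1%:R%:E * (j.+1%:R^-1)%:E :> \bar R.
      by rewrite -EFinM divff.
    by apply: lee_wpmul2l => //; rewrite lee_fin.
rewrite integral_indic// setIT ge0_integralZl//; last 2 first.
- exact: measurable_kint.
- by move=> x _; exact: kint_ge0.
rewrite pi_K// integral_indic// setIT piC mule1 => h.
by rewrite (le_lt_trans h)// ltry.
Qed.

Let pi_sigma_finite : sigma_finite setT pi.
Proof.
exists level; first by rewrite level_cover.
by move=> j; split; [exact: mlevel|exact: pi_level].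
Qed.

Let pi_invariant A : measurable A -> pi A = \int[pi]_x P x A.
Proof.
move=> mA; pose F j := A `&` level j.
have mF j : measurable (F j) by exact: measurableI.
have ndF : {homo F : m n / (m <= n)%N >-> (m <= n)%O}.
  move=> m n mn; apply/subsetPset; apply: setIS; apply/subsetPset.
  exact: level_nd.
have UF : \bigcup_j F j = A by rewrite -setI_bigcupr level_cover setIT.
have mUF : measurable (\bigcup_j F j) by exact: bigcup_measurable.
have h1 := nondecreasing_cvg_mu (mu := pi) mF mUF ndF.
have h2 := nondecreasing_cvg_mu (mu := mmixture pi P) mF mUF ndF.
rewrite UF in h1 h2.
have e : pi \o F = mmixture pi P \o F.
  apply/funext => j /=; apply: pi_P_fin => //.
  apply: le_lt_trans (pi_level j); apply: le_measure; rewrite ?inE//.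
  exact: subIsetr.
rewrite e in h1.
exact: cvg_unique h1 h2.
Qed.

Lemma regen_measureP :
  [/\ sigma_finite setT regen_measure,
      (forall A, measurable A -> regen_measure A = \int[regen_measure]_x P x A),
      regen_measure C = 1 &
      forall B, measurable B -> B `<=` C -> exists v : S -> R,
        [/\ measurable_fun [set: S] v, (exists M, forall x, 0 <= v x <= M)%R &
          forall x, (\1_B x)%:E + \int[P x]_y (v y)%:E =
                    (v x)%:E + (\1_C x)%:E * regen_measure B]].
Proof.
split => // B mB BC.
pose f y : \bar R := (\1_B y)%:E.
have f0 y : 0 <= f y by rewrite lee_fin.
have mf : measurable_fun [set: S] f.
  by apply/measurable_EFinP; exact: measurable_indic.
have fc y : f y <= c1 y.
  rewrite lee_fin !indicE; case: (boolP (y \in B)) => //= yB.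
  by rewrite mem_set//; apply: BC; exact: set_mem.
have g0 y : 0 <= kint G f y by exact: kint_ge0.
have mg := measurable_kint G f0 mf.
have w0 y : 0 <= kint K (kint G f) y by exact: kint_ge0.
have mw := measurable_kint K g0 mg.
exists (fun x => fine (kint K (kint G f) x)); split.
- exact: measurableT_comp mw.
- exists M => x; rewrite fine_ge0//=.
  by rewrite -lee_fin -(fin_le (w0 x) (w_le x f0 mf fc)) w_le.
- move=> x; have := poisson x f0 mf fc.
  rewrite integral_indic// setIT -(fin_le (w0 x) (w_le x f0 mf fc)) => <-.
  congr (_ + _); apply: eq_integral => y _.
  by rewrite -(fin_le (w0 y) (w_le y f0 mf fc)).
Qed.

End regeneration.

(** * Markov property, visits and avoidance of a set *)

Lemma integral_probability_cst d (T : measurableType d) (R : realType)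
    (Pr : probability T R) (c : \bar R) : (\int[Pr]_w c = c)%E.
Proof.
rewrite integral_cst//; transitivity (c * 1)%E; last by rewrite mule1.
by congr (_ * _)%E; exact: probability_setT.
Qed.

Section kernel_reindex.
Context (R : realType) d1 d2 d3 (T1 : measurableType d1)
  (T2 : measurableType d2) (S : measurableType d3).
Local Open Scope ereal_scope.

Section cut.
Variables (G : set T1) (f : T1 -> T2).

Let indic_ge0 (w : T1) : (0 <= \1_G w :> R)%R. Proof. by []. Qed.

(** Carrying the indicator of an event inside the kernel lets both sides of the
    Markov property be mixtures over the same probability measure. *)
Definition kcut (mG : measurable G) (mf : measurable_fun [set: T1] f)
  (k : R.-ker T2 ~> S) (w : T1) : {measure set S -> \bar R} :=
  mscale (NngNum (indic_ge0 w)) (k (f w)).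

Let measurable_kcut mG mf k U : measurable U ->
  measurable_fun [set: T1] ((kcut mG mf k) ^~ U).
Proof.
move=> mU; apply: emeasurable_funM.
  by apply/measurable_EFinP; exact: measurable_indic.
exact: measurableT_comp (measurable_kernel k _ mU) mf.
Qed.

HB.instance Definition _ mG mf k :=
  isKernel.Build _ _ _ _ _ (kcut mG mf k) (@measurable_kcut mG mf k).

Lemma kint_kcut mG mf k h w : (forall y, 0 <= h y) ->
  measurable_fun [set: S] h ->
  kint (kcut mG mf k) h w = (\1_G w)%:E * kint k h (f w).
Proof. by move=> h0 mh; rewrite /kint ge0_integral_mscale. Qed.

End cut.

End kernel_reindex.

Section markov_property.
Context (R : realType) d (S : measurableType d) (P : R.-pker S ~> S).
Context d' (Omega : measurableType d') (Pr : probability Omega R)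
  (X : nat -> {RV Pr >-> S}).
Hypothesis hX : markov_chain P X.
Local Open Scope ereal_scope.

Lemma pastT n : past X n setT.
Proof.
rewrite -setC0; apply: sigma_algebraC.
exact: (@sigma_algebra0 _ setT).
Qed.

Lemma pastI n A B : past X n A -> past X n B -> past X n (A `&` B).
Proof.
move=> pA pB.
exact: (@measurableI _ (g_sigma_algebraType
  (\bigcup_(i in `I_n.+1) preimage_set_system setT (X i) measurable))).
Qed.

Lemma pastC n A : past X n A -> past X n (~` A).
Proof. exact: sigma_algebraC. Qed.

Lemma pastU n A B : past X n A -> past X n B -> past X n (A `|` B).
Proof.
move=> pA pB.
exact: (@measurableU _ (g_sigma_algebraType
  (\bigcup_(i in `I_n.+1) preimage_set_system setT (X i) measurable))).
Qed.

Lemma past_preimage n i A : (i <= n)%N -> measurable A ->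
  past X n (X i @^-1` A).
Proof.
move=> ilen mA; apply: sub_sigma_algebra; exists i; first by rewrite /= ltnS.
by exists A => //; rewrite setTI.
Qed.

Lemma past_le m n A : (m <= n)%N -> past X m A -> past X n A.
Proof.
move=> mn; apply: sub_sigma_algebra2 => B [i /= im hB]; exists i => //=.
exact: leq_trans im _.
Qed.

Lemma measurable_past n A : past X n A -> measurable A.
Proof.
apply: smallest_sub; first exact: sigma_algebra_measurable.
move=> B [i _ [U mU <-]]; rewrite setTI -[X in measurable X]setTI.
exact: measurable_funPT.
Qed.

(** The defining property says that two mixtures agree as measures, hence they
    give the same integrals. *)
Lemma markov_integral n G f : past X n G -> (forall y, 0 <= f y) ->
  measurable_fun [set: S] f ->
  \int[Pr]_w ((\1_G w)%:E * f (X n.+1 w)) =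
  \int[Pr]_w ((\1_G w)%:E * kint P f (X n w)).
Proof.
move=> pG f0 mf; have mG := measurable_past pG.
have mX i : measurable_fun setT (X i) by exact: measurable_funPT.
pose k0 : R.-ker S ~> S := kdirac (@measurable_id _ S setT).
pose k1 : R.-ker Omega ~> S := kcut mG (mX n.+1) k0.
pose k2 : R.-ker Omega ~> S := kcut mG (mX n) P.
transitivity (\int[Pr]_w kint k1 f w).
  by apply: eq_integral => w _; rewrite kint_kcut// (@kint_pow0 _ _ _ k0).
transitivity (\int[Pr]_w kint k2 f w); last first.
  by apply: eq_integral => w _; rewrite kint_kcut.
rewrite -!integral_mixture//; apply: eq_measure_integral => A mA _.
rewrite /mmixture/= /mixture/= /mscale/=.
have mXA : measurable (X n.+1 @^-1` A).
  by rewrite -[X in measurable X]setTI; exact: (mX n.+1 measurableT A mA).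
transitivity (Pr (G `&` X n.+1 @^-1` A)).
  rewrite -(setIT (_ `&` _)) -integral_indic//; last exact: measurableI.
  by apply: eq_integral => w _; rewrite indicI EFinM diracE.
rewrite hX// integral_mkcond; apply: eq_integral => w _.
by rewrite patchE indicE; case: ifPn; rewrite ?mul1e ?mul0e.
Qed.

Lemma markov_iterate n f : (forall y, 0 <= f y) -> measurable_fun [set: S] f ->
  \int[Pr]_w f (X n w) = \int[Pr]_w kint (kpow P n) f (X 0%N w).
Proof.
elim: n f => [|n IH] f f0 mf.
  by apply: eq_integral => w _; rewrite kint_pow0.
transitivity (\int[Pr]_w ((\1_setT w)%:E * f (X n.+1 w))).
  by apply: eq_integral => w _; rewrite indicT mul1e.
rewrite markov_integral//; last exact: pastT.
transitivity (\int[Pr]_w kint P f (X n w)).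
  by apply: eq_integral => w _; rewrite indicT mul1e.
rewrite IH; first by apply: eq_integral => w _; rewrite kint_powSr.
- by move=> y; exact: kint_ge0.
- exact: measurable_kint.
Qed.

Variable C : set S.
Hypothesis mC : measurable C.

Definition taboo (f : S -> \bar R) : S -> \bar R :=
  kint P (fun y => (\1_(~` C) y)%:E * f y).

Fixpoint avoid k n : set Omega :=
  if n is m.+1 then avoid k m `&` X (k + m).+1 @^-1` (~` C) else setT.

Lemma past_avoid k n : past X (k + n) (avoid k n).
Proof.
elim: n => [|n IH]; first exact: pastT.
rewrite addnS; apply: pastI; first exact: past_le IH.
by apply: past_preimage => //; exact: measurableC.
Qed.

Let cut_ge0 (f : S -> \bar R) y : (forall y, 0 <= f y) ->
  0 <= (\1_(~` C) y)%:E * f y.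
Proof. by move=> f0; rewrite mule_ge0// lee_fin. Qed.

Let mcut (f : S -> \bar R) : measurable_fun [set: S] f ->
  measurable_fun [set: S] (fun y => (\1_(~` C) y)%:E * f y).
Proof.
move=> mf; apply: emeasurable_funM => //; apply/measurable_EFinP.
by apply: measurable_indic; exact: measurableC.
Qed.

Lemma taboo_ge0 f y : (forall y, 0 <= f y) -> 0 <= taboo f y.
Proof. by move=> f0; apply: kint_ge0 => z; exact: cut_ge0. Qed.

Lemma measurable_taboo f : (forall y, 0 <= f y) -> measurable_fun [set: S] f ->
  measurable_fun [set: S] (taboo f).
Proof.
move=> f0 mf; apply: measurable_kint; first by move=> y; exact: cut_ge0.
exact: mcut.
Qed.

Lemma taboo_iterate k n f : (forall y, 0 <= f y) -> measurable_fun [set: S] f ->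
  \int[Pr]_w ((\1_(avoid k n) w)%:E * f (X (k + n)%N w)) =
  \int[Pr]_w iter n taboo f (X k w).
Proof.
elim: n f => [|n IH] f f0 mf.
  by apply: eq_integral => w _; rewrite indicT mul1e addn0.
rewrite iterSr -IH; last 2 first.
- by move=> y; exact: taboo_ge0.
- exact: measurable_taboo.
rewrite -markov_integral;
  [|exact: past_avoid|by move=> y; exact: cut_ge0|exact: mcut].
by apply: eq_integral => w _; rewrite /= indicI EFinM -muleA addnS.
Qed.

Lemma avoid_prob k n : Pr (avoid k n) = \int[Pr]_w iter n taboo (cst 1) (X k w).
Proof.
rewrite -taboo_iterate//; under eq_integral do rewrite mule1.
have mA := measurable_past (@past_avoid k n).
by rewrite integral_indic// setIT.
Qed.

Lemma avoid_nonincreasing k : {homo avoid k : m n / (m <= n)%N >-> (n <= m)%O}.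
Proof.
apply/nonincreasing_seqP => n; apply/subsetPset; exact: subIsetl.
Qed.

Lemma avoidP k n w :
  avoid k n w <-> forall j, (j < n)%N -> ~ C (X (k + j).+1 w).
Proof.
elim: n => [|n IH]; first by split.
split=> [[/IH h hn] j|h].
  by rewrite ltnS leq_eqVlt => /predU1P[->//|]; exact: h.
by split; [apply/IH => j jn; apply: h; exact: ltnW|exact: h].
Qed.

Lemma avoid_cvg k :
  Pr (avoid k n) @[n --> \oo] --> Pr (\bigcap_n avoid k n).
Proof.
have mA n : measurable (avoid k n) := measurable_past (@past_avoid k n).
apply: nonincreasing_cvg_mu => //.
- by rewrite (le_lt_trans (probability_le1 _ _))// ltry.
- exact: bigcap_measurableType.
- exact: avoid_nonincreasing.
Qed.

End markov_property.

(** * Consequences of Harris recurrence *)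

Section harris.
Context (R : realType) d (S : measurableType d) (P : R.-pker S ~> S).
Local Open Scope ereal_scope.
Variables (psi : set S -> \bar R) (C : set S).
Hypothesis harris : harris_recurrent P psi.
Hypothesis mC : measurable C.
Hypothesis psiC : 0 < psi C.

(** By the Borel-Cantelli lemma, a finite expected number of visits would make
    the recurrence event null. *)
Lemma harris_visits_series x : \sum_(n <oo) kpow P n x C = +oo.
Proof.
have := harris x mC psiC; move=> [dO [T [Pr [X [hX X0 XC]]]]].
have mXC n : measurable (X n @^-1` C).
  by rewrite -[Y in measurable Y]setTI; exact: measurable_funPT.
have PX n : Pr (X n @^-1` C) = kpow P n x C.
  pose f y : \bar R := (\1_C y)%:E.
  have mf : measurable_fun [set: S] f.
    by apply/measurable_EFinP; exact: measurable_indic.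
  transitivity (\int[Pr]_w f (X n w)).
    by rewrite -(setIT (_ @^-1` _)) -integral_indic.
  rewrite (markov_iterate hX)//; last by move=> y; rewrite lee_fin.
  transitivity (\int[Pr]_w kpow P n x C); last first.
    by rewrite integral_probability_cst.
  apply: ge0_ae_eq_integral => //.
  - apply: measurableT_comp; last exact: measurable_funPT.
    by apply: measurable_kint => // y; rewrite lee_fin.
  - by move=> w _; apply: kint_ge0 => y; rewrite lee_fin.
  - by apply: filterS X0 => w -> _; rewrite kint_indic.
apply/eqP; rewrite eq_le leey/= leNgt; apply/negP => fin.
have : Pr (lim_sup_set (fun n => X n @^-1` C)) = 0.
  apply: lim_sup_set_cvg0 => //.
  by rewrite (eq_eseriesr (fun n _ => PX n)).
by rewrite XC => /eqP; rewrite onee_eq0.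
Qed.

(** The iterates are the probabilities that the recurrent chain started at x
    avoids C for n steps.  This is a property of the kernel alone, through which
    recurrence passes from the chains given by the hypothesis to any chain. *)
Lemma harris_taboo_cvg x : iter n (taboo P C) (cst 1) x @[n --> \oo] --> 0.
Proof.
have := harris x mC psiC; move=> [dO [T [Pr [X [hX X0 XC]]]]].
have iter_ge0 n y : 0 <= iter n (taboo P C) (cst 1) y.
  by elim: n y => [|n IH] y //=; exact: taboo_ge0.
have miter n : measurable_fun [set: S] (iter n (taboo P C) (cst 1)).
  by elim: n => [|n IH] //=; exact: measurable_taboo.
have PA n : Pr (avoid X C 0 n) = iter n (taboo P C) (cst 1) x.
  rewrite (avoid_prob hX mC).
  transitivity (\int[Pr]_w iter n (taboo P C) (cst 1) x); last first.
    by rewrite integral_probability_cst.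
  apply: ge0_ae_eq_integral => //.
  - by apply: measurableT_comp; [exact: miter|exact: measurable_funPT].
  - by apply: filterS X0 => w -> _.
have mL : measurable (lim_sup_set (fun n => X n @^-1` C)).
  apply: bigcap_measurable => // n _; apply: bigcup_measurable => k _.
  by rewrite -[Y in measurable Y]setTI; exact: measurable_funPT.
have PA0 : Pr (\bigcap_n avoid X C 0 n) = 0.
  apply/eqP; rewrite eq_le measure_ge0 andbT.
  have <- : Pr (~` lim_sup_set (fun n => X n @^-1` C)) = 0.
    by rewrite probability_setC// XC subee.
  apply: le_measure; rewrite ?inE.
  - apply: bigcap_measurableType => n _.
    exact: measurable_past (@past_avoid _ _ _ _ _ _ _ _ mC 0 n).
  - exact: measurableC.
  - move=> w h /(_ 1%N I)[j /= j1 Cj].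
    have := (avoidP X C 0 j w).1 (h j I) j.-1.
    by rewrite !prednK// => /(_ (leqnn _)).
have := @avoid_cvg _ _ _ _ _ Pr X C mC 0; rewrite PA0.
by under eq_fun do rewrite PA.
Qed.

(** Conditionally on X_k = x, avoiding C for n steps after time k has
    probability [iter n (taboo P C) (cst 1) x], which tends to 0; dominated
    convergence then handles an arbitrary law of X_k. *)
Lemma harris_visits_io d' (Omega : measurableType d') (Pr : probability Omega R)
    (X : nat -> {RV Pr >-> S}) (hX : markov_chain P X) :
  {ae Pr, forall w k, exists2 j, (k < j)%N & C (X j w)}.
Proof.
apply: ae_foralln => k.
have iter_ge0 n y : 0 <= iter n (taboo P C) (cst 1) y.
  by elim: n y => [|n IH] y //=; exact: taboo_ge0.
have miter n : measurable_fun [set: S] (iter n (taboo P C) (cst 1)).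
  by elim: n => [|n IH] //=; exact: measurable_taboo.
have iter_le1 n y : iter n (taboo P C) (cst 1) y <= 1.
  elim: n y => [|n IH] y //=; rewrite -[leRHS](@prob_kernel _ _ _ _ _ P y).
  rewrite -[leRHS]mul1e -(kint_cst P); apply: le_kint => //.
  - by move=> z; rewrite mule_ge0// lee_fin.
  - apply: emeasurable_funM => //; apply/measurable_EFinP.
    by apply: measurable_indic; exact: measurableC.
  - move=> z; apply: le_trans (IH z).
    by rewrite indicE; case: (_ \in _); rewrite ?mul1e ?mul0e.
have Pk : Pr (\bigcap_n avoid X C k n) = 0.
  have mXk n :
      measurable_fun setT (fun w => iter n (taboo P C) (cst 1) (X k w)).
    by apply: measurableT_comp; [exact: miter|exact: measurable_funPT].
  have ig : Pr.-integrable setT (cst (1 : \bar R)).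
    exact: (finite_measure_integrable_cst Pr 1%R measurableT).
  have [_ _] := @dominated_convergence _ _ _ Pr setT measurableT
    (fun n w => iter n (taboo P C) (cst 1) (X k w)) (cst 0) (cst 1) mXk
    (measurable_cst _) (aeW _ (fun w _ => harris_taboo_cvg (X k w)))
    ig
    (aeW _ (fun w n _ => etrans (congr1 (fun t => t <= 1)
       (gee0_abs (iter_ge0 n (X k w)))) (iter_le1 n (X k w)))).
  rewrite integral0; under eq_fun do rewrite -(avoid_prob hX mC).
  by move=> h; exact: cvg_unique (@avoid_cvg _ _ _ _ _ Pr X C mC k) h.
exists (\bigcap_n avoid X C k n); split => //.
  apply: bigcap_measurableType => n _.
  exact: measurable_past (@past_avoid _ _ _ _ _ _ _ _ mC k n).
move=> w /= h n _; apply/avoidP => j jn Cj; apply: h.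
by exists (k + j).+1 => //; rewrite ltnS leq_addr.
Qed.

End harris.

(** * Sums along a path, stopped at the k-th visit *)

Section visit_count.
Context (R : realType).
Variables (c : nat -> bool) (f : nat -> R).
Hypothesis fc : forall t, `|f t| <= (c t)%:R.

(** Visits strictly before time n, so that the condition [visits t < k] depends
    on the past of t only. *)
Definition visits n : nat := (\sum_(t < n) c t)%N.

Definition early_sum k n : R := \sum_(t < n | (visits t < k)%N) f t.

Lemma visitsS n : visits n.+1 = (visits n + c n)%N.
Proof. by rewrite /visits big_ord_recr. Qed.

Lemma leq_visits m n : (m <= n)%N -> (visits m <= visits n)%N.
Proof.
move=> /subnK <-; elim: (n - m)%N => // k IH.
by rewrite addSn visitsS; apply: leq_trans IH _; exact: leq_addr.
Qed.

Lemma early_sumS k n :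
  early_sum k n.+1 = early_sum k n + (if (visits n < k)%N then f n else 0).
Proof. by rewrite /early_sum big_mkcond big_ord_recr/= -big_mkcond. Qed.

Lemma early_sum_const k m n : (m <= n)%N -> (k <= visits m)%N ->
  early_sum k n = early_sum k m.
Proof.
move=> /subnK <- km; elim: (n - m)%N => // i IH.
rewrite addSn early_sumS IH ltnNge (leq_trans km) ?addr0//.
by apply: leq_visits; exact: leq_addl.
Qed.

Lemma total_early_sum k n :
  `|\sum_(t < n) f t - early_sum k n| <= (visits n - k)%:R.
Proof.
elim: n => [|n IH]; first by rewrite /early_sum !big_ord0 subrr normr0.
rewrite big_ord_recr/= early_sumS opprD addrACA visitsS.
case: ltnP => h.
  rewrite subrr addr0 (le_trans IH)// ler_nat.
  by apply: leq_sub2r; exact: leq_addr.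
rewrite subr0 (le_trans (ler_normD _ _))// -addnBAC// natrD lerD//.
Qed.

Variables (v q : nat -> R) (M : R).
Hypothesis v0M : forall t, 0 <= v t <= M.
Hypothesis poisson : forall t, f t = v t - q t.

Definition martingale_sum k n : R :=
  \sum_(t < n | (visits t < k)%N) (\sum_(i < t.+1) f i) * (v t.+1 - q t).

Lemma martingale_sumS k n : martingale_sum k n.+1 = martingale_sum k n +
  (if (visits n < k)%N then (\sum_(i < n.+1) f i) * (v n.+1 - q n) else 0).
Proof. by rewrite /martingale_sum big_mkcond big_ord_recr/= -big_mkcond. Qed.

(** Let s_n be the full sum up to n.  In s_n^2 + 2 s_n v_n the increment at time
    n is f_n^2 + 2 f_n q_n plus twice the martingale increment: the cross terms
    cancel by the Poisson equation f = v - q.  Hence the increment apart from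
    the martingale part is bounded and vanishes outside visits.  As v is
    bounded, s_n^2 + 2 s_n v_n controls s_n^2 up to constants. *)
Lemma early_sum_sqr_le k n :
  early_sum k n ^+ 2 / 2 - 2 * M ^+ 2 <=
  (2 * M + 3) * k%:R + 2 * martingale_sum k n.
Proof.
have M0 : 0 <= M by case/andP: (v0M 0) => /le_trans; exact.
have K0 : 0 <= 2 * M + 3 by lra.
have sqr_le (Y x : R) : 0 <= x <= M ->
    Y ^+ 2 / 2 - 2 * M ^+ 2 <= Y ^+ 2 + 2 * Y * x.
  move=> /andP[x0 xM]; have : x ^+ 2 <= M ^+ 2 by rewrite ler_sqr ?nnegrE.
  by have := sqr_ge0 (Y + 2 * x); nra.
(* Until the k-th visit the stopped sum is the full sum, for which the exact
   quadratic form can be propagated; afterwards nothing changes. *)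
have [] // : ((visits n < k)%N -> early_sum k n = \sum_(t < n) f t /\
    (\sum_(t < n) f t) ^+ 2 + 2 * (\sum_(t < n) f t) * v n <=
    (2 * M + 3) * (visits n)%:R + 2 * martingale_sum k n) /\
  early_sum k n ^+ 2 / 2 - 2 * M ^+ 2 <=
    (2 * M + 3) * k%:R + 2 * martingale_sum k n.
elim: n => [|n [IH1 IH2]].
  rewrite /early_sum /martingale_sum /visits !big_ord0; split=> [_|].
    by split=> //; nra.
  rewrite expr0n/= mul0r mulr0 addr0.
  have : 0 <= (2 * M + 3) * k%:R by rewrite mulr_ge0.
  by have := sqr_ge0 M; lra.
rewrite early_sumS martingale_sumS visitsS.
case: (ltnP (visits n) k) => nk; last first.
  rewrite /= !addr0; split=> // h; exfalso.
  by have := leq_ltn_trans (leq_addr (c n) (visits n)) h; rewrite ltnNge nk.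
have [-> IH] := IH1 nk; rewrite big_ord_recr/=.
have key : (\sum_(t < n) f t + f n) ^+ 2 +
    2 * (\sum_(t < n) f t + f n) * v n.+1 <=
    (2 * M + 3) * (visits n + c n)%:R +
    2 * (martingale_sum k n + (\sum_(i < n) f i + f n) * (v n.+1 - q n)).
  have step : f n ^+ 2 + 2 * f n * q n <= (2 * M + 3) * (c n)%:R.
    have -> : q n = v n - f n by rewrite poisson; lra.
    have := fc n; case: (c n) => /=.
      rewrite ler_norml => /andP[fn1 fn2]; case/andP: (v0M n) => v0 vM.
      by rewrite mulr1; nra.
    by rewrite normr_le0 => /eqP ->; rewrite expr0n/= !mulr0 mul0r addr0.
  have fE : f n = v n - q n := poisson n.
  rewrite natrD mulrDr; move: IH step; rewrite fE.
  by set s := \sum_(t < n) f t; nra.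
split=> [_|]; first by split.
apply: le_trans (sqr_le _ _ (v0M n.+1)) _; apply: le_trans key _.
rewrite lerD2r ler_wpM2l// ler_nat.
by case: (c n); rewrite ?addn1 ?addn0 // ltnW.
Qed.

End visit_count.

Section subsequence.
Context (R : realType).

Lemma sum_inv_sqr_le n : \sum_(j < n) (j.+1%:R ^+ 2)^-1 <= 2 :> R.
Proof.
case: n => [|n]; first by rewrite big_ord0.
suff : \sum_(j < n.+1) (j.+1%:R ^+ 2)^-1 <= 2 - n.+1%:R^-1 :> R.
  by move/le_trans; apply; rewrite lerBlDr lerDl invr_ge0.
elim: n => [|n IH]; first by rewrite big_ord1 expr1n invr1; lra.
rewrite big_ord_recr/=; apply: (le_trans (lerD IH (lexx _))).
suff : (n.+2%:R ^+ 2)^-1 <= n.+1%:R^-1 - n.+2%:R^-1 :> R.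
  by move: (_ ^+ 2)^-1 (n.+1%:R^-1) (n.+2%:R^-1) => x y z; lra.
have a0 : 0 < n.+1%:R :> R by [].
rewrite -[n.+2]addn1 natrD; set a := n.+1%:R in a0 *.
have -> : a^-1 - (a + 1)^-1 = (a * (a + 1))^-1 by field; rewrite !gt_eqF//; lra.
rewrite lef_pV2 ?posrE ?mulr_gt0 ?exprn_gt0 ?addr_gt0//.
by rewrite expr2; nra.
Qed.

Lemma isqrt n : exists r, (r ^ 2 <= n < r.+1 ^ 2)%N.
Proof.
elim: n => [|n [r /andP[rn nr]]]; first by exists 0%N.
have [h|h] := ltnP n.+1 (r.+1 ^ 2).
  by exists r; rewrite h (leq_trans rn).
exists r.+1; rewrite h/= (leq_ltn_trans nr)// ltn_exp2r//.
Qed.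

Variables (c : nat -> bool) (f : nat -> R).
Hypothesis fc : forall t, `|f t| <= (c t)%:R.
Hypothesis visits_oo : forall k, exists n, (k <= visits c n)%N.
Variable L : R.
Hypothesis bounded_often : forall n, exists2 m, (n <= m)%N &
  \sum_(j < m) (early_sum c f (j.+1 ^ 2) m) ^+ 2 / (j.+1%:R ^+ 2) ^+ 2 <= L.

(** The stopped sums are eventually constant in time, with final values W_j for
    k = (j + 1)^2.  The bound L makes the series of W_j^2 / (j + 1)^4 converge,
    so W_j = o((j + 1)^2), and between consecutive squares r^2 and (r + 1)^2
    the sum moves by at most 2 r. *)
Lemma total_sum_small (e : R) : 0 < e ->
  exists n0, forall n, (n0 <= n)%N ->
    `|\sum_(t < n) f t| <= e * (visits c n)%:R.
Proof.
move=> e0.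
pose late k := xchoose (visits_oo k).
have lateP k : (k <= visits c (late k))%N := xchooseP (visits_oo k).
pose W j := early_sum c f (j.+1 ^ 2) (late (j.+1 ^ 2)%N).
pose u j : R := W j ^+ 2 / (j.+1%:R ^+ 2) ^+ 2.
have u_ge0 j : 0 <= u j by rewrite divr_ge0 ?sqr_ge0.
have uL J : \sum_(0 <= j < J) u j <= L.
  have [m Jm mL] := bounded_often (maxn J (\max_(j < J) late (j.+1 ^ 2)%N)).
  apply: le_trans mL; rewrite big_mkord.
  have JM : (J <= m)%N := leq_trans (leq_maxl _ _) Jm.
  rewrite (big_ord_widen m u JM) big_mkcond; apply: ler_sum => j _.
  case: ifPn => jJ; last by rewrite divr_ge0 ?sqr_ge0.
  rewrite /u /W (@early_sum_const _ c f _ (late (j.+1 ^ 2)%N) m)//.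
  apply: leq_trans (leq_trans (leq_maxr _ _) Jm).
  exact: (leq_bigmax (Ordinal jJ)).
have u_cvg : u @ \oo --> (0 : R).
  apply: cvg_series_cvg_0; apply: nondecreasing_is_cvgn.
    by apply: nondecreasing_series => n _.
  by exists L => _ [n _ <-]; exact: uL.
have e20 : 0 < (e / 2) ^+ 2 by rewrite exprn_gt0// divr_gt0.
have [j0 _ j0P] : \forall j \near \oo, u j <= (e / 2) ^+ 2.
  have /cvgr0Pnorm_le /(_ _ e20) := u_cvg.
  by apply: filterS => j; rewrite ger0_norm.
pose r0 := maxn j0.+1 (Num.truncn (4 / e)).+1.
exists (late (r0 ^ 2)%N) => n n0n.
have [r /andP[rN Nr]] := isqrt (visits c n).
have r0r : (r0 <= r)%N.
  have := leq_ltn_trans (leq_trans (lateP _) (leq_visits c n0n)) Nr.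
  by rewrite ltn_exp2r.
have [i ri] : exists i, r = i.+1.
  by exists r.-1; rewrite prednK// (leq_trans _ r0r)// leq_max.
have j0i : (j0 <= i)%N by rewrite -ltnS -ri (leq_trans _ r0r)// leq_max leqnn.
have Wi : `|W i| <= e / 2 * r%:R ^+ 2.
  have := j0P i j0i; rewrite /u -ri ler_pdivrMr; last first.
    by rewrite !exprn_gt0// ri.
  rewrite -exprMn -(@ler_pXn2r _ 2 _ `|W i|)// ?nnegrE//.
    by rewrite -normrX ger0_norm ?sqr_ge0.
  by rewrite mulr_ge0 ?sqr_ge0// ltW// divr_gt0.
have -> : \sum_(t < n) f t = (\sum_(t < n) f t - early_sum c f (r ^ 2) n) + W i.
  rewrite /W -ri.
  rewrite -(@early_sum_const _ c f _ _ (maxn n (late (r ^ 2)%N)) (leq_maxr _ _))//.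
  by rewrite (@early_sum_const _ c f _ _ _ (leq_maxl _ _) rN) subrK.
apply: (le_trans (ler_normD _ _)).
apply: (le_trans (lerD (total_early_sum fc _ _) Wi)).
have h1 : (visits c n - r ^ 2)%:R <= 2 * r%:R :> R.
  rewrite -natrM ler_nat leq_subLR -ltnS (leq_trans Nr)//.
  by rewrite -addn1 sqrnD exp1n muln1 addnAC addn1 ltnS.
have h2 : 4 / e <= r%:R.
  apply: le_trans (ltW (truncnS_gt _)) _; rewrite ler_nat.
  by rewrite (leq_trans _ r0r)// leq_max leqnn orbT.
have h3 : r%:R ^+ 2 <= (visits c n)%:R :> R by rewrite -natrX ler_nat.
have h4 : 4 <= e * r%:R by rewrite mulrC -ler_pdivrMr.
have r_ge0 : 0 <= r%:R :> R by [].
by nra.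
Qed.

End subsequence.

(** * Second moments and the frequency of visits *)

Section liminf.
Context (R : realType).

Lemma limn_einf_le (u : nat -> \bar R) (A : \bar R) :
  (forall n, (u n <= A)%E) -> (limn_einf u <= A)%E.
Proof.
move=> uA; rewrite limn_einf_lim; apply: lime_le; first exact: is_cvg_einfs.
apply: nearW => n; apply: le_trans (uA n).
by apply: ereal_inf_lbound; exists n => /=.
Qed.

Lemma limn_einf_lty (u : nat -> R) : (limn_einf (EFin \o u) < +oo)%E ->
  exists L, forall n, exists2 m, (n <= m)%N & u m <= L.
Proof.
move=> uoo; apply: contrapT => /forallNP h.
suff uy : (EFin \o u) @ \oo --> +oo%E.
  by move: uoo; rewrite (cvg_limn_einf_sup uy).1 ltxx.
apply/cvgeyPge => A; have /existsNP [n hn] := h A.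
exists n => // m /= nm; rewrite lee_fin leNgt; apply/negP => /ltW um.
by apply: hn; exists m.
Qed.

End liminf.

Section bounded_variables.
Context (R : realType) d (T : measurableType d) (Pr : probability T R).

Definition bounded_rv (f : T -> R) : Prop :=
  measurable_fun setT f /\ exists M, forall w, `|f w| <= M.

Definition mean (f : T -> R) : R := \int[Pr]_w f w.

Lemma bounded_rv_integrable f : bounded_rv f -> Pr.-integrable setT (EFin \o f).
Proof.
move=> [mf [M fM]]; apply: measurable_bounded_integrable => //.
  by rewrite (le_lt_trans (probability_le1 _ _))// ltry.
exists M; split; first exact: num_real.
by move=> x Mx w _ /=; rewrite (le_trans (fM w))// ltW.
Qed.

Lemma bounded_rv_cst r : bounded_rv (fun=> r).
Proof. by split=> //; exists `|r|. Qed.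

Lemma bounded_rv_indic A : measurable A -> bounded_rv (\1_A : T -> R).
Proof.
move=> mA; split; first exact: measurable_indic.
by exists 1 => w; rewrite indicE normr_nat lern1 leq_b1.
Qed.

Lemma bounded_rvD f g : bounded_rv f -> bounded_rv g ->
  bounded_rv (fun w => f w + g w).
Proof.
move=> [mf [M fM]] [mg [N gN]]; split; first exact: measurable_funD.
by exists (M + N) => w; rewrite (le_trans (ler_normD _ _))// lerD.
Qed.

Lemma bounded_rvM f g : bounded_rv f -> bounded_rv g ->
  bounded_rv (fun w => f w * g w).
Proof.
move=> [mf [M fM]] [mg [N gN]]; split; first exact: measurable_funM.
by exists (M * N) => w; rewrite normrM ler_pM.
Qed.

Lemma bounded_rvZ r f : bounded_rv f -> bounded_rv (fun w => r * f w).
Proof. by move=> bf; apply: bounded_rvM => //; exact: bounded_rv_cst. Qed.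

Lemma bounded_rvB f g : bounded_rv f -> bounded_rv g ->
  bounded_rv (fun w => f w - g w).
Proof.
move=> bf bg; have := bounded_rvD bf (bounded_rvZ (-1) bg).
by under eq_fun do rewrite mulN1r.
Qed.

Lemma bounded_rv_sum n (f : 'I_n -> T -> R) : (forall i, bounded_rv (f i)) ->
  bounded_rv (fun w => \sum_(i < n) f i w).
Proof.
move=> bf; have -> : (fun w => \sum_(i < n) f i w) = \sum_(i < n) f i.
  by apply/funext => w; rewrite fct_sumE.
elim/big_ind : _ => //; [exact: bounded_rv_cst|exact: bounded_rvD].
Qed.

Lemma meanD f g : bounded_rv f -> bounded_rv g ->
  mean (fun w => f w + g w) = mean f + mean g.
Proof.
by move=> bf bg; apply: RintegralD => //; exact: bounded_rv_integrable.
Qed.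

Lemma meanZ r f : bounded_rv f -> mean (fun w => r * f w) = r * mean f.
Proof.
by move=> bf; apply: RintegralZl => //; exact: bounded_rv_integrable.
Qed.

Lemma meanB f g : bounded_rv f -> bounded_rv g ->
  mean (fun w => f w - g w) = mean f - mean g.
Proof.
by move=> bf bg; apply: RintegralB => //; exact: bounded_rv_integrable.
Qed.

Lemma mean_cst r : mean (fun=> r) = r.
Proof. by rewrite /mean /Rintegral integral_probability_cst. Qed.

Lemma mean_sum n (f : 'I_n -> T -> R) : (forall i, bounded_rv (f i)) ->
  mean (fun w => \sum_(i < n) f i w) = \sum_(i < n) mean (f i).
Proof.
elim: n f => [|n IH] f bf.
  rewrite big_ord0 -[RHS]mean_cst.
  by congr mean; apply/funext => w; rewrite big_ord0.
rewrite big_ord_recr/= -IH// -meanD//; last exact: bounded_rv_sum.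
by congr mean; apply/funext => w; rewrite big_ord_recr.
Qed.

Lemma le_mean f g : bounded_rv f -> bounded_rv g -> (forall w, f w <= g w) ->
  mean f <= mean g.
Proof.
move=> bf bg fg; apply: le_Rintegral => //; exact: bounded_rv_integrable.
Qed.

Lemma EFin_mean f : bounded_rv f -> (mean f)%:E = (\int[Pr]_w (f w)%:E)%E.
Proof.
move=> bf; rewrite /mean /Rintegral fineK//.
exact: integrable_fin_num (bounded_rv_integrable bf).
Qed.

End bounded_variables.

Section second_moment.
Context (R : realType) d (S : measurableType d) (P : R.-pker S ~> S).
Context d' (T : measurableType d') (Pr : probability T R)
  (X : nat -> {RV Pr >-> S}).
Hypothesis hX : markov_chain P X.
Variables (C B : set S).
Hypotheses (mC : measurable C) (mB : measurable B) (BC : B `<=` C).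
Variables (v : S -> R) (M p : R).
Hypotheses (mv : measurable_fun [set: S] v) (v0M : forall x, 0 <= v x <= M).
Hypothesis p01 : 0 <= p <= 1.
Hypothesis poisson : forall x,
  ((\1_B x)%:E + \int[P x]_y (v y)%:E = (v x)%:E + (\1_C x)%:E * p%:E)%E.

Let c (w : T) (t : nat) : bool := X t w \in C.
Let f (w : T) (t : nat) : R := \1_B (X t w) - p * \1_C (X t w).
Let vX (w : T) (t : nat) : R := v (X t w).
Let q (w : T) (t : nat) : R := vX w t - f w t.

Let fc w t : `|f w t| <= (c w t)%:R.
Proof.
rewrite /f /c !indicE; case: (boolP (X t w \in B)) => xB.
  rewrite mem_set/=; last by apply: BC; exact: set_mem.
  by rewrite mulr1 ler_norml; case/andP: p01 => *; apply/andP; split; lra.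
case: (boolP (X t w \in C)) => xC /=; last by rewrite mulr0 subrr normr0.
by rewrite mulr1 sub0r normrN ger0_norm; case/andP: p01.
Qed.

Let early_event k n : set T := [set w | (visits (c w) n < k)%N].

Let past_early_event k n : past X n (early_event k n).
Proof.
elim: n k => [|n IH] k.
  rewrite /early_event; case: k => [|k].
    rewrite (_ : [set _ | _] = set0); first exact: (@sigma_algebra0 _ setT).
    by apply/seteqP; split => w.
  rewrite (_ : [set _ | _] = setT); first exact: pastT.
  by apply/seteqP; split => w //= _; rewrite /visits big_ord0.
have pC : past X n.+1 (X n @^-1` C) by exact: past_preimage.
rewrite (_ : early_event k n.+1 = (early_event k n `&` ~` (X n @^-1` C)) `|`
    (early_event k.-1 n `&` X n @^-1` C)).
  apply: pastU; apply: pastI => //; last exact: past_le (IH _).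
    exact: past_le (IH _).
  exact: pastC.
apply/seteqP; split => w; rewrite /early_event/= visitsS /c.
  case: (boolP (X n w \in C)) => [xC|xC] /=.
    rewrite addn1 => h; right; split; last exact: set_mem.
    by case: k h.
  by rewrite addn0 => h; left; split => //; move: xC; rewrite notin_setE.
move=> [[h xC]|[h /mem_set xC]]; first by rewrite memNset// addn0.
by rewrite xC addn1; case: k h.
Qed.

Let measurable_early_event k n : measurable (early_event k n).
Proof. exact: measurable_past (@past_early_event k n). Qed.

Let mXA t A : measurable A -> measurable (X t @^-1` A).
Proof.
by move=> mA; rewrite -[Y in measurable Y]setTI; exact: measurable_funPT.
Qed.

Let bounded_vX t : bounded_rv (fun w => vX w t).
Proof.
split; first by apply: measurableT_comp => //; exact: measurable_funPT.
by exists M => w; case/andP: (v0M (X t w)) => v0 vM; rewrite ger0_norm.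
Qed.

Let bounded_f t : bounded_rv (fun w => f w t).
Proof.
have bX (A : set S) (mA : measurable A) : bounded_rv (fun w => \1_A (X t w) : R).
  have E : (fun w => \1_A (X t w)) = \1_(X t @^-1` A) :> (T -> R).
    by apply/funext => w; rewrite !indicE; congr (nat_of_bool _)%:R;
      apply/idP/idP; rewrite !inE.
  by have := bounded_rv_indic R (mXA t mA); rewrite -E.
by apply: bounded_rvB; [exact: bX|apply: bounded_rvZ; exact: bX].
Qed.

Let bounded_q t : bounded_rv (fun w => q w t).
Proof. exact: bounded_rvB. Qed.

Let Pv x : kint P (fun y => (v y)%:E) x = (v x - (\1_B x - p * \1_C x))%:E.
Proof.
move: (poisson x); rewrite /kint -EFinM -EFinD.
case: (\int[P x]_y (v y)%:E)%E => [r||]//.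
by rewrite -EFinD => -[e]; congr (_%:E); lra.
Qed.

(** The increments v(X_(t+1)) - P v(X_t) are orthogonal to the past of t. *)
Let increment_mean0 G t : past X t G ->
  mean Pr (fun w => \1_G w * (vX w t.+1 - q w t)) = 0.
Proof.
move=> pG; have mG := measurable_past pG.
have bG := bounded_rv_indic R mG.
have -> : (fun w => \1_G w * (vX w t.+1 - q w t)) =
    (fun w => \1_G w * vX w t.+1 - \1_G w * q w t).
  by apply/funext => w; rewrite mulrBr.
rewrite meanB; try exact: bounded_rvM.
apply/eqP; rewrite subr_eq0; apply/eqP; apply: EFin_inj.
rewrite !EFin_mean; try exact: bounded_rvM.
under eq_integral do rewrite EFinM.
rewrite (@markov_integral _ _ _ _ _ _ _ _ hX t G (fun y => (v y)%:E))//.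
- by apply: eq_integral => w _; rewrite Pv -EFinM.
- by move=> y; rewrite lee_fin; case/andP: (v0M y).
- exact/measurable_EFinP.
Qed.

Let early_sumE k n w : early_sum (c w) (f w) k n =
  \sum_(t < n) \1_(early_event k t) w * f w t.
Proof.
rewrite /early_sum big_mkcond; apply: eq_bigr => t _.
rewrite indicE; case: ifPn => h; first by rewrite mem_set// mul1r.
by rewrite memNset ?mul0r//; exact/negP.
Qed.

Let bounded_early_sum k n : bounded_rv (fun w => early_sum (c w) (f w) k n).
Proof.
under eq_fun do rewrite early_sumE.
apply: bounded_rv_sum => t; apply: bounded_rvM => //.
exact: bounded_rv_indic.
Qed.

(** The weights multiplying the increments are combinations of indicators of
    events of the past. *)
Let martingaleE k n w :
  martingale_sum (c w) (f w) (vX w) (q w) k n =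
  \sum_(t < n) \sum_(i < t.+1)
    (\1_(early_event k t `&` X i @^-1` B) w * (vX w t.+1 - q w t) -
     p * (\1_(early_event k t `&` X i @^-1` C) w * (vX w t.+1 - q w t))).
Proof.
rewrite /martingale_sum big_mkcond; apply: eq_bigr => t _.
transitivity (\1_(early_event k t) w *
    ((\sum_(i < t.+1) f w i) * (vX w t.+1 - q w t))).
  rewrite indicE; case: ifPn => h; first by rewrite mem_set// mul1r.
  by rewrite memNset ?mul0r//; exact/negP.
rewrite mulrA mulr_sumr mulr_suml; apply: eq_bigr => i _.
rewrite !indicI /f [X in X * _ - _]/= mulrA -mulrBl; congr (_ * _).
by rewrite mulrBr; congr (_ - _); rewrite mulrCA.
Qed.

Let bounded_increment G t : measurable G ->
  bounded_rv (fun w => \1_G w * (vX w t.+1 - q w t)).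
Proof.
move=> mG; apply: bounded_rvM; first exact: bounded_rv_indic.
exact: bounded_rvB.
Qed.

Let bounded_martingale k n :
  bounded_rv (fun w => martingale_sum (c w) (f w) (vX w) (q w) k n).
Proof.
under eq_fun do rewrite martingaleE.
apply: bounded_rv_sum => t; apply: bounded_rv_sum => i.
apply: bounded_rvB; last apply: bounded_rvZ;
  by apply: bounded_increment; apply: measurableI => //; exact: mXA.
Qed.

Let martingale_mean0 k n :
  mean Pr (fun w => martingale_sum (c w) (f w) (vX w) (q w) k n) = 0.
Proof.
under eq_fun do rewrite martingaleE.
have bI (A : set S) (mA : measurable A) t i :
    bounded_rv (fun w => \1_(early_event k t `&` X i @^-1` A) w *
      (vX w t.+1 - q w t)).
  by apply: bounded_increment; apply: measurableI => //; exact: mXA.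
rewrite mean_sum; last first.
  move=> t; apply: bounded_rv_sum => i; apply: bounded_rvB; first exact: bI.
  by apply: bounded_rvZ; exact: bI.
apply: big1 => t _; rewrite mean_sum; last first.
  by move=> i; apply: bounded_rvB; [exact: bI|apply: bounded_rvZ; exact: bI].
apply: big1 => i _; rewrite meanB; [|exact: bI|by apply: bounded_rvZ; exact: bI].
rewrite meanZ; last exact: bI.
by rewrite !increment_mean0 ?mulr0 ?subr0//; apply: pastI => //;
  apply: past_preimage => //; rewrite -ltnS.
Qed.

Lemma early_sum_second_moment k n :
  mean Pr (fun w => early_sum (c w) (f w) k n ^+ 2) <=
  2 * (2 * M + 3) * k%:R + 4 * M ^+ 2.
Proof.
have bm := bounded_martingale k n.
apply: (@le_trans _ _ (mean Pr (fun w => 2 * (2 * M + 3) * k%:R + 4 * M ^+ 2 +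
    4 * martingale_sum (c w) (f w) (vX w) (q w) k n))).
  apply: le_mean.
  - by under eq_fun do rewrite expr2; exact: bounded_rvM.
  - by apply: bounded_rvD; [exact: bounded_rv_cst|exact: bounded_rvZ].
  - move=> w; have := @early_sum_sqr_le _ (c w) (f w) (fc w) (vX w) (q w) M.
    move=> /(_ (fun t => v0M _)) /(_ _ k n) h.
    have {h} := h (fun t => esym (subKr (vX w t) (f w t))).
    by set Y := early_sum _ _ _ _; set D := martingale_sum _ _ _ _ _ _; lra.
rewrite meanD; [|exact: bounded_rv_cst|exact: bounded_rvZ].
by rewrite meanZ// martingale_mean0 mulr0 addr0 mean_cst.
Qed.

(** The expectations of the sums over j are bounded uniformly in m, so by
    Fatou's lemma their lower limit is almost surely finite. *)
Lemma ae_early_sum_bounded :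
  {ae Pr, forall w, exists L : R, forall n, exists2 m, (n <= m)%N &
    \sum_(j < m) early_sum (c w) (f w) (j.+1 ^ 2) m ^+ 2 / (j.+1%:R ^+ 2) ^+ 2
      <= L}.
Proof.
pose H m w : R :=
  \sum_(j < m) early_sum (c w) (f w) (j.+1 ^ 2) m ^+ 2 / (j.+1%:R ^+ 2) ^+ 2.
have bY j m : bounded_rv (fun w => early_sum (c w) (f w) j m ^+ 2).
  by under eq_fun do rewrite expr2; exact: bounded_rvM.
have bterm m j : bounded_rv (fun w =>
    early_sum (c w) (f w) (j.+1 ^ 2) m ^+ 2 / (j.+1%:R ^+ 2) ^+ 2).
  by apply: bounded_rvM => //; exact: bounded_rv_cst.
have bH m : bounded_rv (H m) by apply: bounded_rv_sum => j.
have H0 m w : 0 <= H m w by apply: sumr_ge0 => j _; rewrite divr_ge0 ?sqr_ge0.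
have M0 : 0 <= M by case/andP: (v0M point) => /le_trans; exact.
pose A := 2 * (2 * M + 3) + 4 * M ^+ 2.
have A0 : 0 <= A by rewrite /A; have := sqr_ge0 M; lra.
have EH m : mean Pr (H m) <= A * 2.
  rewrite /H mean_sum//.
  apply: (@le_trans _ _ (\sum_(j < m) A * (j.+1%:R ^+ 2)^-1)); last first.
    by rewrite -mulr_sumr ler_wpM2l// sum_inv_sqr_le.
  apply: ler_sum => j _.
  under eq_fun do rewrite mulrC; rewrite meanZ//.
  have j0 : 0 < j.+1%:R ^+ 2 :> R by rewrite exprn_gt0.
  rewrite mulrC ler_pdivrMr ?exprn_gt0// -mulrA expr2 mulKf ?gt_eqF//.
  apply: (le_trans (early_sum_second_moment _ _)).
  have r1 : 1 <= j.+1%:R ^+ 2 :> R by rewrite expr_ge1// ler1n.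
  rewrite natrX /A -expr2; have := sqr_ge0 M.
  move: (j.+1%:R ^+ 2) (M ^+ 2) r1 => r y r1 y0.
  have h : 0 <= y * (r - 1) by rewrite mulr_ge0// subr_ge0.
  by rewrite [leRHS]mulrDl lerD2l; nra.
have mH m : measurable_fun [set: T] (fun w => (H m w)%:E).
  by apply/measurable_EFinP; exact: (bH m).1.
have fat : (\int[Pr]_w limn_einf (fun m => (H m w)%:E) <= (A * 2)%:E)%E.
  apply: (le_trans (fatou Pr measurableT mH _)).
    by move=> m w _; rewrite lee_fin.
  by apply: limn_einf_le => m; rewrite -EFin_mean// lee_fin.
have mg : measurable_fun [set: T] (fun w => limn_einf (fun m => (H m w)%:E)).
  have mN m := measurableT_comp (@oppe_measurable _ setT) (mH m).
  by have := measurable_fun_limn_esup mN; apply: measurableT_comp.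
have g0 w : (0 <= limn_einf (fun m => (H m w)%:E))%E.
  rewrite limn_einf_lim; apply: lime_ge; first exact: is_cvg_einfs.
  by apply: nearW => n; apply: le_ereal_inf_tmp => _ [m _ <-]; rewrite lee_fin.
have ig : Pr.-integrable setT (fun w => limn_einf (fun m => (H m w)%:E)).
  apply/integrableP; split=> //; apply: le_lt_trans (ltry (A * 2)).
  by under eq_integral do rewrite gee0_abs//.
apply: filterS (integrable_ae measurableT ig) => w /(_ I) hw.
have : (limn_einf (fun m => (H m w)%:E) < +oo)%E by rewrite -ge0_fin_numE.
exact: (@limn_einf_lty _ (H ^~ w)).
Qed.

Lemma ae_visit_frequency :
  {ae Pr, forall w k, exists2 j, (k < j)%N & C (X j w)} ->
  {ae Pr, forall w, forall e : R, 0 < e -> exists n0, forall n, (n0 <= n)%N ->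
    `|\sum_(t < n) \1_B (X t w) - p * \sum_(t < n) \1_C (X t w)| <=
    e * \sum_(t < n) \1_C (X t w)}.
Proof.
move=> io; move: io ae_early_sum_bounded; apply: filterS2 => w io [L hL] e e0.
have visits_oo k : exists n, (k <= visits (c w) n)%N.
  elim: k => [|k [n kn]]; first by exists 0%N.
  have [j nj Cj] := io n; exists j.+1.
  rewrite visitsS /c mem_set//= addn1 ltnS (leq_trans kn)//.
  by apply: leq_visits; exact: ltnW.
have [n0 hn0] := total_sum_small (fc w) visits_oo hL e0.
exists n0 => n /hn0.
rewrite /f sumrB -mulr_sumr /visits natr_sum.
by under [X in _ <= e * X -> _]eq_bigr do rewrite /c -indicE.
Qed.

End second_moment.

Section small_set_chain.
Context (R : realType) d (S : measurableType d) (P : R.-pker S ~> S).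
Local Open Scope ereal_scope.
Variables (psi : {measure set S -> \bar R}) (C : set S).
Hypothesis harris : harris_recurrent P psi.
Hypothesis Csmall : small_set P psi C.

(** The normalization pi(C) = 1 makes pi(B) the limiting proportion. *)
Lemma small_set_ergodic : exists pi : {sigma_finite_measure set S -> \bar R},
  [/\ invariant_measure P pi, pi C = 1 &
  forall d' (T : measurableType d') (Pr : probability T R)
    (X : nat -> {RV Pr >-> S}), markov_chain P X ->
  {ae Pr, forall w k, exists2 j, (k < j)%N & C (X j w)} /\
  forall B, measurable B -> B `<=` C ->
  {ae Pr, forall w, forall e : R, (0 < e)%R ->
    exists n0, forall n, (n0 <= n)%N ->
    (`|\sum_(t < n) \1_B (X t w) - fine (pi B) * \sum_(t < n) \1_C (X t w)| <=
    e * \sum_(t < n) \1_C (X t w))%R}].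
Proof.
have [mC psiC [m0 [nu' [m0_gt0 nu'_gt0 minor]]]] := Csmall.
have [x Cx] : C !=set0.
  apply/set0P/negP => /eqP C0; move: psiC.
  by rewrite C0 measure0 ltxx.
pose lam : {measure set S -> \bar R} := mscale (half_pow R m0) nu'.
have lamE A : lam A = (2^-1 ^+ m0.+1)%:E * nu' A by [].
have half_gt0 : 0 < (2^-1 ^+ m0.+1 : R)%:E.
  by rewrite lte_fin exprn_gt0// invr_gt0.
have lam_gt0 : 0 < lam setT by rewrite lamE mule_gt0.
have lam_le y A : measurable A -> (\1_C y)%:E * lam A <= resolvent P y A.
  move=> mA; apply: le_trans (kpow_le_resolvent P m0 y mA).
  rewrite lamE muleCA lee_pmul2l//.
  by rewrite -kiter_kpow; exact: minor.
have lam_ltoo : lam setT < +oo.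
  have := lam_le x _ measurableT.
  rewrite indicE mem_set// mul1e resolventT => /le_lt_trans; apply.
  exact: ltry.
have [Q KQ] : exists Q : R.-ker S ~> S, forall y A, measurable A ->
    resolvent P y A = Q y A + (\1_C y)%:E * lam A.
  apply: kernel_difference => //.
  by move=> y; rewrite resolventT ltry.
have rec := harris_visits_series harris mC psiC.
have [sf inv piC poisson] := regen_measureP mC lam_gt0 lam_ltoo rec KQ.
pose sfm := Measure_isSigmaFinite.Build _ _ _ (regen_measure lam Q) sf.
pose pi : {sigma_finite_measure set S -> \bar R} :=
  HB.pack (Measure.sort (regen_measure lam Q)) sfm.
exists pi; split => //.
move=> d' T Pr X hX.
have io := harris_visits_io harris mC psiC hX.
split => // B mB BC.
have [v [mv [M vM] pois]] := poisson B mB BC.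
have pB1 : pi B <= 1 by rewrite -piC; apply: le_measure; rewrite ?inE.
have pBE : pi B = (fine (pi B))%:E.
  by rewrite fineK// ge0_fin_numE// (le_lt_trans pB1)// ltry.
have p01 : (0 <= fine (pi B) <= 1)%R.
  by rewrite fine_ge0//= -lee_fin -pBE.
apply: (ae_visit_frequency hX mC mB BC mv vM p01) => //.
by move=> y; rewrite -pBE; exact: pois.
Qed.

End small_set_chain.

(** * From pointwise to uniform convergence *)

Section uniform_convergence.
Context (R : realType).
(** [F] is a distribution function and [Fm y] stands for its left limit at [y];
    likewise for [Fn] and [Fnm] below. *)
Variables (F Fm : R -> R) (a b : R).
Hypothesis F_nd : {homo F : x y / x <= y}.
Hypothesis F_ge0 : forall y, 0 <= F y.
Hypothesis F_lt : forall y, y < a -> F y = 0.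
Hypothesis F_ge : forall y, b <= y -> F y = 1.
Hypothesis F_right : forall y t, (forall z, y < z -> t <= F z) -> t <= F y.
Hypothesis F_left : forall y t, (forall z, z < y -> F z <= t) -> Fm y <= t.

Definition quantile_grid (L i : nat) : R :=
  inf [set y | i.+1%:R / L.+1%:R <= F y].

Let grid_inf L i : (i <= L)%N -> has_inf [set y | i.+1%:R / L.+1%:R <= F y].
Proof.
move=> iL; split.
  by exists b; rewrite /= F_ge// ler_pdivrMr// mul1r ler_nat.
exists a => y /= h; rewrite leNgt; apply/negP => /F_lt Fy0.
by move: h; rewrite Fy0 leNgt divr_gt0.
Qed.

Let F_grid L i : (i <= L)%N -> i.+1%:R / L.+1%:R <= F (quantile_grid L i).
Proof.
move=> /grid_inf hinf; apply: F_right => z hz.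
have [y /= hy yz] := inf_lt hinf.1 hz.
by apply: le_trans hy (F_nd (ltW yz)).
Qed.

Let Fm_grid L i : (i <= L)%N -> Fm (quantile_grid L i) <= i.+1%:R / L.+1%:R.
Proof.
move=> /grid_inf hinf; apply: F_left => z hz.
rewrite leNgt; apply/negP => /ltW h.
have : quantile_grid L i <= z by apply: ge_inf => //; exact: hinf.2.
by rewrite leNgt hz.
Qed.

Variables (Fn Fnm : nat -> R -> R).
Hypothesis Fn_nd : forall n, {homo Fn n : x y / x <= y}.
Hypothesis Fn01 : forall n y, 0 <= Fn n y <= 1.
Hypothesis Fn_left : forall n z y, z < y -> Fn n z <= Fnm n y.
Hypothesis Fn_cvg : forall L i (e : R), 0 < e ->
  exists n0, forall n, (n0 <= n)%N ->
  `|Fn n (quantile_grid L i) - F (quantile_grid L i)| <= e.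
Hypothesis Fnm_cvg : forall L i (e : R), 0 < e ->
  exists n0, forall n, (n0 <= n)%N ->
  `|Fnm n (quantile_grid L i) - Fm (quantile_grid L i)| <= e.

(** Between two consecutive grid points F varies by at most 1 / (L + 1) once the
    jump at the right end is left out, which is why left limits are controlled
    there too. *)
Lemma grid_uniform_cvg (e : R) : 0 < e -> exists n0, forall n, (n0 <= n)%N ->
  forall y, `|Fn n y - F y| <= e.
Proof.
move=> e0; have e20 : 0 < e / 2 by rewrite divr_gt0.
pose L := Num.truncn (2 / e).
have L_gt0 : 0 < L.+1%:R :> R by [].
have Le : L.+1%:R^-1 <= e / 2.
  rewrite -[leRHS]invrK lef_pV2 ?posrE ?invr_gt0// invf_div.
  exact/ltW/truncnS_gt.
have [n1 hn1] : exists n1, forall n, (n1 <= n)%N -> forall i, (i <= L)%N ->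
    `|Fn n (quantile_grid L i) - F (quantile_grid L i)| <= e / 2 /\
    `|Fnm n (quantile_grid L i) - Fm (quantile_grid L i)| <= e / 2.
  elim: {1}L => [|k [m hm]].
    have [m1 h1] := Fn_cvg L 0 e20; have [m2 h2] := Fnm_cvg L 0 e20.
    exists (maxn m1 m2) => n; rewrite geq_max => /andP[n1 n2] i.
    by rewrite leqn0 => /eqP ->; split; [exact: h1|exact: h2].
  have [m1 h1] := Fn_cvg L k.+1 e20; have [m2 h2] := Fnm_cvg L k.+1 e20.
  exists (maxn m (maxn m1 m2)) => n; rewrite !geq_max => /and3P[n0 n1 n2] i.
  rewrite leq_eqVlt => /predU1P[->|ik]; first by split; [exact: h1|exact: h2].
  exact: hm.
exists n1 => n n1n y; have {hn1} hn := hn1 n n1n.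
have /andP[Fn0 Fn1] := Fn01 n y.
have F0 := F_ge0 y.
have F1 : F y <= 1.
  by rewrite -(F_ge (lexx b)); have [yb|/ltW by_] := leP y b;
    [exact: F_nd|rewrite (F_ge by_) F_ge].
pose i := Num.truncn (F y * L.+1%:R).
have /andP[iF Fi] : (i%:R <= F y * L.+1%:R) && (F y * L.+1%:R < i.+1%:R).
  by rewrite truncn_le truncnS_gt mulr_ge0.
have lower : F y - e <= Fn n y.
  case: (i) iF Fi => [_|k kF] Fi.
    have : F y <= L.+1%:R^-1 by rewrite -[leRHS]mul1r ler_pdivlMr// ltW.
    by move: (L.+1%:R^-1) Le => x; lra.
  have kL : (k <= L)%N.
    by rewrite -ltnS -(ltr_nat R) (lt_le_trans _ (le_trans kF _)) ?ltr_nat//;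
      rewrite ler_piMl.
  have gy : quantile_grid L k <= y.
    by apply: ge_inf; [exact: (grid_inf kL).2|rewrite /= ler_pdivrMr].
  have [h _] := hn k kL.
  have := Fn_nd n gy; have := F_grid kL.
  move: h; rewrite ler_norml => /andP[h _].
  have : F y <= k.+1%:R / L.+1%:R + L.+1%:R^-1.
    by rewrite -[X in _ + X]mul1r -mulrDl ler_pdivlMr// natr1 ltW.
  by move: (L.+1%:R^-1) Le (k.+1%:R / L.+1%:R) => x Le z; lra.
have upper : Fn n y <= F y + e.
  have [iL|Li] := leqP i L; last first.
    have : 1 <= F y.
      rewrite -(ler_pM2r L_gt0) mul1r; apply: le_trans iF; by rewrite ler_nat.
    by lra.
  have yg : y < quantile_grid L i.
    rewrite ltNge; apply/negP => /F_nd; rewrite leNgt => /negP; apply.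
    by apply: lt_le_trans (F_grid iL); rewrite ltr_pdivlMr.
  have [_ h] := hn i iL.
  have := Fn_left n yg; have := Fm_grid iL.
  move: h; rewrite ler_norml => /andP[_ h].
  have : i.+1%:R / L.+1%:R <= F y + L.+1%:R^-1.
    by rewrite -natr1 mulrDl mul1r lerD2r ler_pdivrMr.
  by move: (L.+1%:R^-1) Le (i.+1%:R / L.+1%:R) => x Le z; lra.
by rewrite ler_norml; apply/andP; split; lra.
Qed.

End uniform_convergence.

(** * Empirical distribution functions and their quantiles *)

Section empirical_distribution.
Context (R : realType) (C : set R).
Implicit Types (x : nat -> R) (n : nat).

Lemma Tn_ge0 x n : 0 <= Tn C x n.
Proof. by apply: sumr_ge0 => t _. Qed.

Let count_le x n (A : set R) :
  \sum_(t < n.+1) \1_(C `&` A) (x t) <= Tn C x n.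
Proof.
by apply: ler_sum => t _; rewrite indicI ler_piMr// indicE ler_nat leq_b1.
Qed.

Lemma ratio01 x n (A : set R) :
  0 <= (Tn C x n)^-1 * \sum_(t < n.+1) \1_(C `&` A) (x t) <= 1.
Proof.
rewrite mulr_ge0 ?invr_ge0 ?Tn_ge0 ?sumr_ge0//=.
have := Tn_ge0 x n; rewrite le_eqVlt => /predU1P[<-|T0].
  by rewrite invr0 mul0r.
by rewrite mulrC ler_pdivrMr// mul1r count_le.
Qed.

Lemma le_ratio x n (A B : set R) : A `<=` B ->
  (Tn C x n)^-1 * \sum_(t < n.+1) \1_(C `&` A) (x t) <=
  (Tn C x n)^-1 * \sum_(t < n.+1) \1_(C `&` B) (x t).
Proof.
move=> AB; rewrite ler_wpM2l ?invr_ge0 ?Tn_ge0//; apply: ler_sum => t _.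
rewrite !indicE ler_nat; case: (boolP (x t \in C `&` A)) => //.
by rewrite inE => -[Ct At]; rewrite mem_set//; split=> //; exact: AB.
Qed.

Lemma Fn_nd x n : {homo Fn C x n : y z / y <= z}.
Proof. by move=> y z yz; apply: le_ratio => u /= /le_trans; exact. Qed.

Lemma mem_visited x n z :
  z \in visited C x n <-> exists2 t, (t <= n)%N & x t = z /\ C z.
Proof.
rewrite /visited mem_sort mem_undup; split.
  move=> /mapP[t]; rewrite mem_filter mem_iota add0n ltnS => /andP[xC tn] ->.
  by exists t => //; split=> //; exact: set_mem.
move=> [t tn [<- Ct]]; apply/mapP; exists t => //.
by rewrite mem_filter mem_iota add0n ltnS mem_set.
Qed.

Lemma visited_bounds x n z : z \in visited C x n -> Y1 C x n <= z <= Ym C x n.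
Proof.
move=> zs; rewrite /Y1 /Ym -nth0 -nth_last.
have srt : sorted <=%R (visited C x n) by exact: sort_sorted le_total _.
have iz : (index z (visited C x n) < size (visited C x n))%N.
  by rewrite index_mem.
have s0 : (0 < size (visited C x n))%N by exact: leq_ltn_trans iz.
have mono := sorted_leq_nth le_trans le_refl 0 srt.
have zE := nth_index 0 zs; apply/andP; split.
  by rewrite -[leRHS]zE; apply: mono.
rewrite -[leLHS]zE; apply: mono; rewrite ?inE ?prednK//.
by rewrite -ltnS prednK.
Qed.

(** The largest visited point not above y gives the same value of [Fn]. *)
Lemma Fn_attained x n p y : 0 < p -> p <= Fn C x n y ->
  exists2 z, z \in visited C x n & z <= y /\ p <= Fn C x n z.
Proof.
move=> p0 py.
have [t0 Pt0] : exists t : 'I_n.+1, (x t \in C) && (x t <= y).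
  apply: contrapT => /forallNP none; move: py; rewrite leNgt => /negP; apply.
  rewrite /Fn big1 ?mulr0// => t _; rewrite indicE memNset// => -[/= Ct ty].
  by apply: (none t); rewrite mem_set.
case: (@arg_maxP _ _ _ t0 (fun t : 'I_n.+1 => (x t \in C) && (x t <= y))
  (fun t => x t) Pt0) => t /andP[xC xy] tmax.
exists (x t).
  by apply/mem_visited; exists t; [rewrite -ltnS|split=> //; exact: set_mem].
split=> //; apply: le_trans py _.
rewrite /Fn ler_wpM2l ?invr_ge0 ?Tn_ge0//; apply: ler_sum => u _.
rewrite !indicE; case: (boolP (x u \in _ `&` [set z | z <= y])) => //.
rewrite inE => -[/= Cu uy]; rewrite mem_set//; split=> //=.
by apply: tmax; rewrite mem_set.
Qed.

(** By the previous lemma the least visited point where [Fn] reaches p is the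
    smallest element of the set that defines the quantile. *)
Lemma Fn_invP x n Y0 p y : 0 < p -> p <= Fn C x n y ->
  (1 <= Tn C x n -> Y0 < Y1 C x n) ->
  p <= Fn C x n (Fn_inv C x n Y0 p) /\ Fn_inv C x n Y0 p <= y.
Proof.
move=> p0 py Y0Y1.
have att := Fn_attained p0.
have [z0 /mem_visited[t0 t0n [xt0 Cz0]] [_ pz0]] := att _ _ _ py.
have Pt0 : (x (Ordinal (t0n : (t0 < n.+1)%N)) \in C) &&
    (p <= Fn C x n (x (Ordinal (t0n : (t0 < n.+1)%N)))).
  by rewrite /= xt0 mem_set.
case: (@arg_minP _ _ _ (Ordinal (t0n : (t0 < n.+1)%N))
  (fun t : 'I_n.+1 => (x t \in C) && (p <= Fn C x n (x t)))
  (fun t => x t) Pt0) => t /andP[xC xp] tmin.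
have tv : x t \in visited C x n.
  by apply/mem_visited; exists t; [rewrite -ltnS|split=> //; exact: set_mem].
have least u : p <= Fn C x n u -> x t <= u.
  move=> /att[z /mem_visited[s sn [xs Cz]] [zu pz]]; apply: le_trans zu.
  have := tmin (Ordinal (sn : (s < n.+1)%N)) => /=.
  by rewrite xs mem_set//=; exact.
have T1 : 1 <= Tn C x n.
  rewrite /Tn (bigD1 t)//= indicE xC lerDl.
  by apply: sumr_ge0.
have [ge1 lem] := andP (visited_bounds tv).
have -> : Fn_inv C x n Y0 p = x t.
  apply: xget_unique => /=.
    split; last by move=> u /= [_ /least].
    by split=> //; rewrite lem (le_trans _ ge1)// ltW// Y0Y1.
  move=> u /= [[/andP[_ _] pu] lbu]; apply/le_anti; rewrite least// andbT.
  apply: lbu => /=; split=> //.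
  by rewrite lem (le_trans _ ge1)// ltW// Y0Y1.
by split=> //; exact: least.
Qed.

End empirical_distribution.

Section quantile.
Context (R : realType) (x0 delta : R) (F : R -> R).
Hypothesis delta_gt0 : 0 < delta.
Let C : set R := `[x0 - delta, x0 + delta]%classic.
Hypothesis F_ge0 : forall y, 0 <= F y.
Hypothesis F_cont : {within C, continuous F}.
Hypothesis F_incr : {in C &, {homo F : y z / y < z}}.

Let F_homo y z : x0 - delta <= y -> y < z -> z <= x0 + delta -> F y < F z.
Proof.
move=> y1 yz z2; apply: F_incr => //; rewrite inE /C/= in_itv/=; apply/andP.
  by split=> //; rewrite (le_trans (ltW yz)).
by split=> //; rewrite (le_trans y1 (ltW yz)).
Qed.

Let F_continuous y : x0 - delta < y -> y < x0 + delta -> {for y, continuous F}.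
Proof.
move=> y1 y2; apply: within_continuous_continuous F_cont _; first by lra.
by rewrite in_itv/= y1.
Qed.

Let F_inj : {in C &, injective F}.
Proof.
move=> y z Cy Cz FE; apply/eqP; case: ltgtP => // h.
  by have := F_incr Cy Cz h; rewrite FE ltxx.
by have := F_incr Cz Cy h; rewrite FE ltxx.
Qed.

Let x1 := x0 - delta / 2.
Let x2 := x0 + delta / 2.

(** The increment over a length g is continuous and positive on a compact set,
    hence bounded away from 0. *)
Let gap (g : R) : 0 < g -> g <= delta / 4 -> exists2 eta, 0 < eta &
  forall y, x1 - g <= y -> y <= x2 -> eta <= F (y + g) - F y.
Proof.
move=> g0 gd; have x12 : x1 - g <= x2 by rewrite /x1 /x2; lra.
have cD : {within `[x1 - g, x2]%classic, continuous (fun y => F (y + g) - F y)}.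
  apply: continuous_in_subspaceT => y; rewrite inE/= in_itv/= => /andP[y1 y2].
  apply: (@continuousB _ _ _ (fun y => F (y + g)) F).
    apply: (@continuous_comp _ _ _ (fun y => y + g) F).
      by apply: (@continuousD _ _ _ id (cst g)); [exact: cvg_id|exact: cvg_cst].
    by apply: F_continuous; move: y1 y2; rewrite /x1 /x2; lra.
  by apply: F_continuous; move: y1 y2; rewrite /x1 /x2; lra.
have [m] := EVT_min x12 cD.
rewrite in_itv/= => /andP[m1 m2] mmin; exists (F (m + g) - F m).
  by rewrite subr_gt0; apply: F_homo; move: m1 m2; rewrite /x1 /x2; lra.
by move=> y y1 y2; apply: mmin; rewrite in_itv/= y1.
Qed.

(** Levels within this distance of F(x0) are attained by F at points within
    delta / 2 of x0, which leaves room on both sides inside C. *)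
Definition quantile_radius : R := Num.min (F x0 - F x1) (F x2 - F x0).

Lemma quantile_radius_gt0 : 0 < quantile_radius.
Proof.
rewrite /quantile_radius lt_min !subr_gt0.
by rewrite !F_homo// /x1 /x2; have := delta_gt0; lra.
Qed.

(** If [Fn] is closer to F than the increment of F over a length g, it lies
    below p at q - g and reaches p at q + g, where F q = p. *)
Lemma quantile_cvg (x : nat -> R) (Y0 : nat -> R) :
  (forall n, 1 <= Tn C x n -> Y0 n < Y1 C x n) ->
  (forall e, 0 < e -> exists n0, forall n, (n0 <= n)%N ->
    forall y, `|Fn C x n y - F y| <= e) ->
  forall e, 0 < e -> exists n0, forall n, (n0 <= n)%N ->
    forall p, `|p - F x0| <= quantile_radius ->
      `|Fn_inv C x n (Y0 n) p - F_inv C F p| <= e.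
Proof.
move=> Y0Y1 Fcvg e e0.
pose g := Num.min e (delta / 4).
have g0 : 0 < g by rewrite lt_min e0 divr_gt0.
have ge : g <= e by rewrite ge_min lexx.
have gd : g <= delta / 4 by rewrite ge_min lexx orbT.
have [eta eta0 etaP] := gap g0 gd.
have eta20 : 0 < eta / 2 by rewrite divr_gt0.
have [n0 n0P] := Fcvg _ eta20.
exists n0 => n /n0P Fn_F p.
have x1E : x1 = x0 - delta / 2 by [].
have x2E : x2 = x0 + delta / 2 by [].
rewrite ler_norml => /andP[p1 p2].
have r1 : quantile_radius <= F x0 - F x1 by rewrite ge_min lexx.
have r2 : quantile_radius <= F x2 - F x0 by rewrite ge_min lexx orbT.
have x12 : x1 <= x2 by lra.
have F12 : F x1 < F x2 by apply: F_homo; lra.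
have cont12 : {within `[x1, x2], continuous F}.
  apply: continuous_in_subspaceT => y; rewrite inE/= in_itv/= => /andP[y1 y2].
  by apply: F_continuous; lra.
have [q] : exists2 q, q \in `[x1, x2] & F q = p.
  apply: IVT => //; rewrite min_l ?max_r ?(ltW F12)//.
  by apply/andP; split; lra.
rewrite in_itv/= => /andP[q1 q2] Fq.
have Cq : C q by rewrite /C/= in_itv/=; apply/andP; split; lra.
have -> : F_inv C F p = q by rewrite /F_inv -Fq pinvKV// mem_set.
have p0 : 0 < p.
  have : F (x0 - delta) < F q by apply: F_homo; lra.
  by rewrite Fq; apply: le_lt_trans.
have gapr : eta <= F (q + g) - F q by apply: etaP; lra.
have gapl : eta <= F q - F (q - g).
  by have := etaP (q - g); rewrite subrK; apply; lra.
have pn : p <= Fn C x n (q + g).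
  have := Fn_F (q + g); rewrite ler_norml => /andP[h _].
  by move: gapr; rewrite Fq; lra.
have [pinv qinv] := Fn_invP p0 pn (Y0Y1 n).
have qg : q - g < Fn_inv C x n (Y0 n) p.
  rewrite ltNge; apply/negP => /(@Fn_nd _ C x n) h.
  have := Fn_F (q - g); rewrite ler_norml => /andP[_ h'].
  by move: gapl; rewrite Fq; lra.
by rewrite ler_norml; apply/andP; split; lra.
Qed.

End quantile.

(** * Distribution function of the normalized measure *)

Section distribution_function.
Context (R : realType) d (T : measurableType d)
  (mu : {measure set T -> \bar R}).
Variables (f : T -> R) (a b : R).
Hypothesis mf : measurable_fun [set: T] f.
Let C : set R := `[a, b]%classic.
Hypothesis muC : mu (f @^-1` C) = 1%E.

Definition cdf_le (y : R) : R := fine (mu (f @^-1` (C `&` [set z | z <= y]))).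
Definition cdf_lt (y : R) : R := fine (mu (f @^-1` (C `&` [set z | z < y]))).

Let mpre A : measurable A -> measurable (f @^-1` A).
Proof. by move=> mA; rewrite -[Y in measurable Y]setTI; exact: mf. Qed.

Let mC : measurable C. Proof. exact: measurable_itv. Qed.

Let mle y : measurable (f @^-1` (C `&` [set z | z <= y])).
Proof. by apply: mpre; apply: measurableI => //; rewrite -set_itvNyc. Qed.

Let mlt y : measurable (f @^-1` (C `&` [set z | z < y])).
Proof. by apply: mpre; apply: measurableI => //; rewrite -set_itvNyo. Qed.

Let part_fin A : measurable (f @^-1` (C `&` A)) ->
  mu (f @^-1` (C `&` A)) = (fine (mu (f @^-1` (C `&` A))))%:E.
Proof.
move=> mA; rewrite fineK// ge0_fin_numE//; apply: le_lt_trans (ltry 1).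
rewrite -muC; apply: le_measure; rewrite ?inE//; first exact: mpre.
exact: preimage_subset (@subIsetl _ _ _).
Qed.

Lemma cdf_le_nd : {homo cdf_le : x y / x <= y}.
Proof.
move=> x y xy; rewrite -lee_fin -!part_fin//; apply: le_measure; rewrite ?inE//.
by apply: preimage_subset; apply: setIS => z /= /le_trans; exact.
Qed.

Lemma cdf_le_ge0 y : 0 <= cdf_le y. Proof. exact: fine_ge0. Qed.

Lemma cdf_le_lt y : y < a -> cdf_le y = 0.
Proof.
move=> ya; rewrite /cdf_le (_ : f @^-1` _ = set0) ?measure0//.
apply/seteqP; split => // x [/=]; rewrite /C/= in_itv/= => /andP[ax _].
by move=> /(le_trans ax); rewrite leNgt ya.
Qed.

Lemma cdf_le_ge y : b <= y -> cdf_le y = 1.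
Proof.
move=> yb; rewrite /cdf_le (_ : f @^-1` _ = f @^-1` C) ?muC//.
apply/seteqP; split => [x []//|x Cx]; split=> //=.
by move: Cx; rewrite /C/= in_itv/= => /andP[_ /le_trans]; exact.
Qed.

Lemma cdf_le_right y t : (forall z, y < z -> t <= cdf_le z) -> t <= cdf_le y.
Proof.
move=> h; pose A (k : nat) := f @^-1` (C `&` [set z | z <= y + k.+1%:R^-1]).
have AE : \bigcap_k A k = f @^-1` (C `&` [set z | z <= y]).
  apply/seteqP; split=> x.
    move=> Ax; split; first by have [] := Ax 0%N I.
    apply/ler_addgt0Pl => e e0 /=.
    have [_ /= ] := Ax (Num.truncn e^-1) I; move/le_trans; apply.
    rewrite addrC lerD2r -[leRHS]invrK lef_pV2 ?posrE ?invr_gt0//.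
    exact/ltW/truncnS_gt.
  by move=> [/= Cx xy] k _; split=> //=; rewrite (le_trans xy)// lerDl.
have cv : mu (A k) @[k --> \oo] --> mu (\bigcap_k A k).
  apply: nonincreasing_cvg_mu => //.
  - by rewrite (part_fin (mle _)) ltry.
  - by move=> k; exact: mle.
  - by rewrite AE.
  - move=> m n mn; apply/subsetPset; apply: preimage_subset.
    apply: setIS => z /=.
    by move/le_trans; apply; rewrite lerD2l lef_pV2 ?posrE// ler_nat.
rewrite -lee_fin -part_fin// -AE -(cvg_lim _ cv)//.
apply: lime_ge; first by apply/cvg_ex; eexists; exact: cv.
apply: nearW => k; rewrite /A part_fin// lee_fin; apply: h.
by rewrite ltrDl.
Qed.

Lemma cdf_lt_left y t : (forall z, z < y -> cdf_le z <= t) -> cdf_lt y <= t.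
Proof.
move=> h; pose A (k : nat) := f @^-1` (C `&` [set z | z <= y - k.+1%:R^-1]).
have AE : \bigcup_k A k = f @^-1` (C `&` [set z | z < y]).
  apply/seteqP; split=> x.
    move=> [k _ [/= Cx xk]]; split=> //=.
    by rewrite (le_lt_trans xk)// ltrBlDr ltrDl.
  move=> [/= Cx xy]; exists (Num.truncn (y - f x)^-1) => //; split=> //=.
  rewrite lerBrDl -lerBrDr -[leRHS]invrK lef_pV2 ?posrE ?invr_gt0 ?subr_gt0//.
  exact/ltW/truncnS_gt.
have cv : mu (A k) @[k --> \oo] --> mu (\bigcup_k A k).
  apply: nondecreasing_cvg_mu => //.
  - by move=> k; exact: mle.
  - by rewrite AE.
  - move=> m n mn; apply/subsetPset; apply: preimage_subset.
    apply: setIS => z /=.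
    by move/le_trans; apply; rewrite lerD2l lerN2 lef_pV2 ?posrE// ler_nat.
rewrite -lee_fin -part_fin// -AE -(cvg_lim _ cv)//.
apply: lime_le; first by apply/cvg_ex; eexists; exact: cv.
apply: nearW => k; rewrite /A part_fin// lee_fin; apply: h.
by rewrite ltrBlDr ltrDl.
Qed.

End distribution_function.

Lemma cvg_ereal_sup0 (R : realType) (I : Type) (A : set I) (h : nat -> I -> R) :
  A !=set0 ->
  (forall e, 0 < e -> exists n0, forall n, (n0 <= n)%N ->
     forall y, A y -> `|h n y| <= e) ->
  ereal_sup [set (`|h n y|)%:E | y in A] @[n --> \oo] --> (0%E : \bar R).
Proof.
move=> [y0 Ay0] hA.
have sup_ge0 n : (0 <= ereal_sup [set (`|h n y|)%:E | y in A])%E.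
  apply: (@le_trans _ _ (`|h n y0|)%:E); first by rewrite lee_fin.
  by apply: ereal_sup_ubound; exists y0.
apply/fine_cvgP; split.
  have [n0 hn0] := hA 1 ltr01; exists n0 => // n /= n0n.
  rewrite ge0_fin_numE//; apply: le_lt_trans (ltry 1).
  by apply: ge_ereal_sup => _ [y Ay <-]; rewrite lee_fin hn0.
apply/cvgr0Pnorm_le => e e0; have [n0 hn0] := hA e e0.
exists n0 => // n /= n0n; rewrite ger0_norm ?fine_ge0//.
have se : (ereal_sup [set (`|h n y|)%:E | y in A] <= e%:E)%E.
  by apply: ge_ereal_sup => _ [y Ay <-]; rewrite lee_fin hn0.
rewrite -lee_fin fineK// ge0_fin_numE//; exact: le_lt_trans se (ltry e).
Qed.

Theorem lemma5p1 (R : realType) (E : set R) (e0 : E)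
  (P : R.-pker (state_space e0) ~> (state_space e0))
  (psi : {sigma_finite_measure set (state_space e0) -> \bar R})
  (hpsi : maximal_irreducibility_measure P psi)
  (harris : harris_recurrent P psi)
  (s : state_space e0 -> R) (nu : probability (state_space e0) R)
  (ms : measurable_fun setT s)
  (s01 : forall x, 0 <= s x <= 1)
  (s_nu : (0 < \int[nu]_x (s x)%:E)%E)
  (minorization : forall x A, measurable A -> ((s x)%:E * nu A <= P x A)%E)
  (d : measure_display) (Omega : measurableType d) (Pr : probability Omega R)
  (X : nat -> {RV Pr >-> state_space e0})
  (hX : markov_chain P X)
  (x0 delta : R) (delta_gt0 : 0 < delta)
  (CE : `[x0 - delta, x0 + delta]%classic `<=` E)
  (Csmall : small_set P psi
     (to_real e0 @^-1` `[x0 - delta, x0 + delta]%classic)) :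
  let C : set R := `[x0 - delta, x0 + delta]%classic in
  let path (w : Omega) (t : nat) : R := to_real e0 (X t w) in
  exists pi : {sigma_finite_measure set (state_space e0) -> \bar R},
    let F : R -> R := stationary_cdf pi C in
    [/\ invariant_measure P pi,
        (0 < pi (to_real e0 @^-1` C) < +oo)%E,
        {ae Pr, forall w,
          ereal_sup [set (`|Fn C (path w) n y - F y|)%:E | y in [set: R]]
            @[n --> \oo] --> 0%E} &
        {within C, continuous F} ->
        strictly_increasing_on C F ->
        forall Y0 : nat -> {RV Pr >-> R},
          (forall n w, 1 <= Tn C (path w) n -> Y0 n w < Y1 C (path w) n) ->
        exists2 eps0 : R, 0 < eps0 &
          forall eps : R, 0 < eps <= eps0 ->
          {ae Pr, forall w,
            ereal_sup [set (`|Fn_inv C (path w) n (Y0 n w) p - F_inv C F p|)%:E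
                        | p in [set p | `|p - F x0| <= eps]]
              @[n --> \oo] --> 0%E}].
Proof.
move=> C path.
have [pi [inv piC ergodic]] := small_set_ergodic harris Csmall.
have [io freq] := ergodic _ _ Pr X hX.
exists pi => F.
pose f : state_space e0 -> R := to_real e0.
have mf : measurable_fun [set: state_space e0] f.
  by move=> _ B mB; exists B.
have mpre B : measurable B -> measurable (f @^-1` B).
  by move=> mB; rewrite -[Y in measurable Y]setTI; exact: mf.
have mC : measurable C by exact: measurable_itv.
pose G := cdf_le pi f (x0 - delta) (x0 + delta).
pose Gm := cdf_lt pi f (x0 - delta) (x0 + delta).
have FG : F = G.
  apply/funext => y; rewrite /F /stationary_cdf.
  transitivity (G y / 1); last by rewrite divr1.
  congr (_ / _); transitivity (fine (1%E : \bar R)) => //.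
  by congr fine; exact: piC.
have G_nd : {homo G : x y / x <= y} by exact: cdf_le_nd.
have G_ge0 y : 0 <= G y by exact: cdf_le_ge0.
have G_lt y : y < x0 - delta -> G y = 0 by exact: cdf_le_lt.
have G_ge y : x0 + delta <= y -> G y = 1 by exact: cdf_le_ge.
have G_right y t : (forall z, y < z -> t <= G z) -> t <= G y.
  exact: cdf_le_right.
have G_left y t : (forall z, z < y -> G z <= t) -> Gm y <= t.
  exact: cdf_lt_left.
pose Fnm (x : nat -> R) n y : R :=
  (Tn C x n)^-1 * \sum_(t < n.+1) \1_(C `&` [set z | z < y]) (x t).
(* The grid depends on G alone, so that countably many almost sure
   convergences suffice. *)
pose grid L i := quantile_grid G L i.
have freqR (A : set R) : measurable A -> {ae Pr, forall w,
    forall e : R, 0 < e -> exists n0, forall n, (n0 <= n)%N ->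
    `|(Tn C (path w) n)^-1 * \sum_(t < n.+1) \1_(C `&` A) (path w t) -
      fine (pi (f @^-1` (C `&` A)))| <= e}.
  move=> mA; set B := f @^-1` (C `&` A).
  have mB : measurable B by apply: mpre; exact: measurableI.
  have BC : B `<=` f @^-1` C by exact: preimage_subset (@subIsetl _ _ _).
  move: io (freq B mB BC); apply: filterS2 => w io_w freq_w e e0'.
  have [n1 n1P] := freq_w e e0'.
  have [j _ Cj] := io_w 0%N.
  (* From the first visit to C on, one can divide by the number of visits. *)
  exists (maxn n1 j) => n; rewrite geq_max => /andP[n1n jn].
  have pathE (D : set R) t : \1_(f @^-1` D) (X t w) = \1_D (path w t) :> R.
    by rewrite !indicE; congr (nat_of_bool _)%:R; apply/idP/idP; rewrite !inE.
  have := n1P n.+1 (leqW n1n).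
  under eq_bigr do rewrite pathE.
  under [X in _ * X]eq_bigr do rewrite pathE.
  under [X in _ <= _ * X]eq_bigr do rewrite pathE.
  rewrite -/(Tn C (path w) n).
  have T0 : 0 < Tn C (path w) n.
    rewrite /Tn (bigD1 (Ordinal (jn : (j < n.+1)%N)))//= indicE mem_set//.
    by rewrite ltr_wpDr// sumr_ge0.
  move=> h.
  rewrite -(@ler_pM2r _ (Tn C (path w) n))//.
  rewrite -[X in `|_| * X]gtr0_norm// -normrM.
  by rewrite mulrBl mulrAC mulVf ?gt_eqF// mul1r.
have unif : {ae Pr, forall w, forall e : R, 0 < e -> exists n0, forall n,
    (n0 <= n)%N -> forall y, `|Fn C (path w) n y - F y| <= e}.
  have cv : {ae Pr, forall w L i,
      (forall e : R, 0 < e -> exists n0, forall n, (n0 <= n)%N ->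
        `|Fn C (path w) n (grid L i) - G (grid L i)| <= e) /\
      (forall e : R, 0 < e -> exists n0, forall n, (n0 <= n)%N ->
        `|Fnm (path w) n (grid L i) - Gm (grid L i)| <= e)}.
    apply: ae_foralln => L; apply: ae_foralln => i.
    have h1 := freqR [set z | z <= grid L i].
    have h2 := freqR [set z | z < grid L i].
    apply: filterS2 (h1 _) (h2 _) => //.
    - by rewrite -set_itvNyc.
    - by rewrite -set_itvNyo.
  apply: filterS cv => w cv_w e e0'; rewrite FG.
  apply: (@grid_uniform_cvg _ G Gm (x0 - delta) (x0 + delta) G_nd G_ge0 G_lt
    G_ge G_right G_left (Fn C (path w)) (Fnm (path w))) => //.
  - by move=> n; exact: Fn_nd.
  - by move=> n y; exact: ratio01.
  - by move=> n z y zy; apply: le_ratio => u /= /le_lt_trans; exact.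
  - by move=> L i; exact: (cv_w L i).1.
  - by move=> L i; exact: (cv_w L i).2.
split=> //.
- by rewrite piC lte01 ltry.
- apply: filterS unif => w hw.
  apply: (cvg_ereal_sup0 (h := fun n y => Fn C (path w) n y - F y)).
    by exists 0.
  move=> e e0'; have [n0 hn0] := hw e e0'.
  by exists n0 => n /hn0 h y _; exact: h.
- move=> Fcont [Fincr _] Y0 Y0Y1.
  have F_ge0 y : 0 <= F y by rewrite FG.
  exists (quantile_radius x0 delta F); first exact: quantile_radius_gt0.
  move=> eps /andP[eps0 epsr]; apply: filterS unif => w hw.
  apply: (cvg_ereal_sup0 (h := fun n p =>
    Fn_inv C (path w) n (Y0 n w) p - F_inv C F p)).
    by exists (F x0); rewrite /= subrr normr0 ltW.
  move=> e e0'.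
  have [n0 hn0] := quantile_cvg delta_gt0 F_ge0 Fcont Fincr
    (fun n => Y0Y1 n w) hw e0'.
  by exists n0 => n /hn0 h p /= pe; apply: h; exact: le_trans pe epsr.
Qed.
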